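(* Let $\mathbb{K}=\mathbb{R}$ or $\mathbb{C}$, $d\ge1$, and let $\mathcal{K}\subseteq\mathcal{H}(d)$ be compact. Assume there is a constant $\Theta$ such that for all $\mathcal{M}\in\mathcal{K}$ with $\rho(\mathcal{M})>0$ and all integers $k\ge1$ we have $$\sup_{S\in\mathcal{S}_k(\mathcal{M})}\|S\|\le\Theta\,k^{d-1}\rho(\mathcal{M})^k .$$ Then there is a constant $\Gamma>0$ such that $$\rho(\mathcal{N})\ge\rho(\mathcal{M})-\Gamma\, d_H(\mathcal{M},\mathcal{N})^{1/(d^2+d)}$$ for all $\mathcal{M},\mathcal{N}\in\mathcal{K}$. In particular, $\rho$ is Hölder continuous on $\mathcal{K}$ with exponent $\alpha=\frac{1}{d^2+d}$.
   Context: $\mathcal{H}(d)$ is the set of nonempty compact subsets of $\mathbb{K}^{d\times d}$ with the Hausdorff metric $d_H(\mathcal{M},\mathcal{N})=\max\{\max_{A\in\mathcal{M}}\min_{B\in\mathcal{N}}\|A-B\|_2,\ \max_{B\in\mathcal{N}}\min_{A\in\mathcal{M}}\|A-B\|_2\}$, where $\|\cdot\|_2$ is the spectral norm. $\|\cdot\|$ is an arbitrary fixed vector norm on $\mathbb{K}^d$ and also its induced operator norm. $\mathcal{S}_k(\mathcal{M})=\{A_{k-1}\cdots A_0 : A_j\in\mathcal{M}\}$ and the joint spectral radius is $\rho(\mathcal{M})=\lim_{k\to\infty}\sup\{\|S\| : S\in\mathcal{S}_k(\mathcal{M})\}^{1/k}$. A function $f:X\to Z$ between metric spaces is Hölder continuous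 on $X$ with exponent $\alpha$ if $\sup_{x\ne y}d_Z(f(x),f(y))/d_X(x,y)^\alpha<\infty$. *)

(* Defs.v *)
From HB Require Import structures.
From mathcomp Require Import all_boot all_order all_algebra.
From mathcomp Require Import all_classical all_reals all_analysis.
From mathcomp Require Import complex.

Set Implicit Arguments.
Unset Strict Implicit.
Unset Printing Implicit Defensive.

Import Order.TTheory GRing.Theory Num.Theory.
Import numFieldNormedType.Exports.

Local Open Scope classical_set_scope.
Local Open Scope ring_scope.

Inductive scalar_kind := RealScalars | ComplexScalars.

Definition scalar_field (R : realType) (s : scalar_kind) : numFieldType :=
  match s with
  | RealScalars => R : numFieldType
  | ComplexScalars => complex R : numFieldType
  end.

(* The library norm of a complex number is itself a complex number; [modulus]
   is the real-valued absolute value on either field. *)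
Definition modulus (R : realType) (s : scalar_kind) : scalar_field R s -> R :=
  match s return scalar_field R s -> R with
  | RealScalars => fun x => `|x|
  | ComplexScalars => fun z => ComplexField.Normc.normc z
  end.
Arguments modulus {R s}.

Section Norms.
Context {R : realType} {s : scalar_kind} {d : nat}.
Local Notation K := (scalar_field R s).

Definition vector_norm (N : 'cV[K]_d -> R) : Prop :=
  [/\ forall x, 0 <= N x,
      forall x, N x = 0 -> x = 0,
      forall (a : K) x, N (a *: x) = modulus a * N x
    & forall x y, N (x + y) <= N x + N y].

(* The supremum is finite (and attained) for every vector norm, the space
   being finite-dimensional. *)
Definition opnorm (N : 'cV[K]_d -> R) (A : 'M[K]_d) : R :=
  sup [set N (A *m x) | x in [set x | N x <= 1]].

Definition euclidean_norm (x : 'cV[K]_d) : R :=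
  Num.sqrt (\sum_i modulus (x i 0) ^+ 2).

Definition spectral_norm : 'M[K]_d -> R := opnorm euclidean_norm.

(* The products A_(k-1) *m ... *m A_0 with all A_j in M. *)
Definition mxprods (M : set 'M[K]_d) (k : nat) : set 'M[K]_d :=
  [set \big[mulmx/1%:M]_(j < k) A (rev_ord j)
     | A in [set A : 'I_k -> 'M[K]_d | forall j, M (A j)]].

(* The limit exists for bounded M; the junk term at k = 0 is irrelevant. *)
Definition joint_spectral_radius (N : 'cV[K]_d -> R) (M : set 'M[K]_d) : R :=
  limn (fun k => sup [set opnorm N S | S in mxprods M k] `^ (k%:R^-1)).

(* The inner infima and outer suprema are attained on nonempty compact sets. *)
Definition hausdorff_dist (M N : set 'M[K]_d) : R :=
  Num.max
    (sup [set inf [set spectral_norm (A - B) | B in N] | A in M])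
    (sup [set inf [set spectral_norm (A - B) | A in M] | B in N]).

End Norms.

(* [compact] refers to the entrywise topology on matrices, which is the one
   induced by any norm. *)
Record hyperspace (R : realType) (s : scalar_kind) (d : nat) := Hyperspace {
  hyperspace_set :> set 'M[scalar_field R s]_d;
  hyperspace_nonempty : hyperspace_set !=set0;
  hyperspace_compact : compact hyperspace_set
}.

Definition hoelder_on (R : realType) (X Z : metricType R) (A : set X)
    (f : X -> Z) (alpha : R) : Prop :=
  (ereal_sup [set (mdist (f p.1) (f p.2) / mdist p.1 p.2 `^ alpha)%:E
     | p in [set p : X * X | [/\ A p.1, A p.2 & p.1 <> p.2]]] < +oo)%E.

Definition of_real (R : realType) (s : scalar_kind) : R -> scalar_field R s :=
  match s return R -> scalar_field R s with
  | RealScalars => fun a => a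
  | ComplexScalars => fun a => real_complex R a
  end.
Arguments of_real {R s}.

Section ModulusTheory.
Context {R : realType} {s : scalar_kind}.
Local Notation K := (scalar_field R s).
Implicit Types x y : K.

Lemma normr_modulus x : `|x| = of_real (modulus x).
Proof. by case: s x => // x. Qed.

Lemma of_real_lt (a b : R) : ((of_real a : K) < of_real b) = (a < b).
Proof. by rewrite /of_real; case: s => //; rewrite ltcR. Qed.

Lemma modulus_ge0 x : 0 <= modulus x.
Proof. by case: s x => /= [|[a b]] //=; rewrite sqrtr_ge0. Qed.

Lemma modulusD x y : modulus (x + y) <= modulus x + modulus y.
Proof.
by case: s x y => x y /=; [exact: ler_normD | exact: le_normcD].
Qed.

Lemma modulusM x y : modulus (x * y) = modulus x * modulus y.
Proof.
by case: s x y => x y /=; [exact: normrM | exact: ComplexField.Normc.normcM].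
Qed.

Lemma modulusN x : modulus (- x) = modulus x.
Proof.
by case: s x => x /=; [exact: normrN | exact: normcN].
Qed.

Lemma modulus0_eq0 x : modulus x = 0 -> x = 0.
Proof.
by case: s x => x /=; [exact: normr0_eq0 | exact: ComplexField.Normc.eq0_normc].
Qed.

Lemma modulus0 : modulus (0 : K) = 0.
Proof. by case: s => /=; [exact: normr0 | exact: ComplexField.Normc.normc0]. Qed.

Lemma modulus1 : modulus (1 : K) = 1.
Proof. by case: s => /=; [exact: normr1 | exact: ComplexField.Normc.normc1]. Qed.

Lemma modulus_ball x y (e : R) : ball x (of_real e) y = (modulus (x - y) < e) :> Prop.
Proof. by rewrite -ball_normE /ball_ /= normr_modulus of_real_lt. Qed.

Lemma of_real_gt0 (e : R) : (0 < of_real e :> K) = (0 < e).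
Proof.
rewrite -of_real_lt; congr (_ < _).
by rewrite /of_real; case: s.
Qed.

Lemma gt0_of_real x : 0 < x -> exists2 e : R, 0 < e & of_real e = x.
Proof.
move=> x0; have xE : of_real (modulus x) = x by rewrite -normr_modulus gtr0_norm.
by exists (modulus x) => //; rewrite -of_real_gt0 xE.
Qed.

Lemma modulus_sum (I : Type) (r : seq I) (F : I -> K) :
  modulus (\sum_(i <- r) F i) <= \sum_(i <- r) modulus (F i).
Proof.
elim/big_ind2 : _ => [|a b c e ab ce|//]; first by rewrite modulus0.
by rewrite (le_trans (modulusD _ _))// lerD.
Qed.

Lemma modulus_continuous : continuous (modulus : K -> R).
Proof.
move=> x; apply/(@cvgrPdist_lt R R K (nbhs x) _ modulus (modulus x)) => e e0.
have e0' : 0 < (of_real e : K) by rewrite of_real_gt0.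
apply: filterS (nbhsx_ballx x (of_real e) e0') => y.
rewrite modulus_ball => xy.
have le u v : modulus u <= modulus v + modulus (u - v :> K).
  by rewrite -{1}(subrKC v u) modulusD.
apply: le_lt_trans xy; rewrite ler_distl lerBlDr ; apply/andP; split.
- by rewrite -[x - y]opprB modulusN le.
- exact: le.
Qed.

End ModulusTheory.

Section EuclideanTheory.
Context {R : realType} {s : scalar_kind} {d : nat}.
Local Notation K := (scalar_field R s).
Local Notation E := (@euclidean_norm R s d).
Local Notation sp := (@spectral_norm R s d).
Implicit Types (A B : 'M[K]_d) (x y : 'cV[K]_d).

Lemma sum_CauchySchwarz (a b : 'I_d -> R) :
  (\sum_i a i * b i) ^+ 2 <= (\sum_i a i ^+ 2) * (\sum_i b i ^+ 2).
Proof.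
have : 0 <= \sum_i \sum_j (a i * b j - a j * b i) ^+ 2.
  by apply: sumr_ge0 => i _; apply: sumr_ge0 => j _; exact: sqr_ge0.
have -> : \sum_i \sum_j (a i * b j - a j * b i) ^+ 2 =
    ((\sum_i a i ^+ 2) * (\sum_i b i ^+ 2) - (\sum_i a i * b i) ^+ 2) *+ 2.
  have pE (f g : 'I_d -> R) :
      \sum_i \sum_j f i * g j = (\sum_i f i) * (\sum_j g j).
    by rewrite mulr_suml; apply: eq_bigr => i _; rewrite mulr_sumr.
  transitivity (\sum_i \sum_j (a i ^+ 2 * b j ^+ 2) +
      \sum_i \sum_j (b i ^+ 2 * a j ^+ 2) -
      (\sum_i \sum_j (a i * b i) * (a j * b j)) *+ 2).
    rewrite -sumrMnl -big_split -sumrB; apply: eq_bigr => i _ /=.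
    rewrite -sumrMnl -big_split -sumrB; apply: eq_bigr => j _ /=.
    rewrite sqrrB !exprMn (mulrC (a j ^+ 2)) [RHS]addrAC; congr (_ - _ *+ 2 + _).
    by rewrite mulrACA (mulrC (b j)) mulrACA (mulrC (a j)) -!mulrA (mulrCA (b i)).
  by rewrite !pE (mulrC (\sum_i b i ^+ 2)) -mulr2n -expr2 mulrnBl.
by rewrite pmulrn_lge0// subr_ge0.
Qed.

Lemma euclidean_norm_ge0 x : 0 <= E x. Proof. exact: sqrtr_ge0. Qed.

Let sq_ge0 (x : 'cV[K]_d) : 0 <= \sum_i modulus (x i 0) ^+ 2.
Proof. by apply: sumr_ge0 => i _; exact: sqr_ge0. Qed.

Lemma modulus_le_euclidean (x : 'cV[K]_d) i : modulus (x i 0) <= E x.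
Proof.
rewrite -(ger0_norm (modulus_ge0 (x i 0))) -sqrtr_sqr ler_wsqrtr//.
by rewrite (bigD1 i)//= lerDl sumr_ge0// => j _; exact: sqr_ge0.
Qed.

Lemma euclidean_le_sum (x : 'cV[K]_d) : E x <= \sum_i modulus (x i 0).
Proof.
have S0 : 0 <= \sum_i modulus (x i 0).
  by apply: sumr_ge0 => i _; exact: modulus_ge0.
rewrite -(ger0_norm S0) -sqrtr_sqr ler_wsqrtr// expr2 mulr_suml.
apply: ler_sum => i _; rewrite expr2 ler_wpM2l ?modulus_ge0//.
by rewrite (bigD1 i)//= lerDl sumr_ge0// => j _; exact: modulus_ge0.
Qed.

Lemma euclidean_vector_norm : vector_norm E.
Proof.
split.
- exact: euclidean_norm_ge0.
- move=> x x0; apply/matrixP => i j; rewrite ord1 mxE; apply: modulus0_eq0.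
  by apply/eqP; rewrite eq_le modulus_ge0 andbT -x0 modulus_le_euclidean.
- move=> a x; rewrite /euclidean_norm.
  under eq_bigr do rewrite mxE modulusM exprMn.
  by rewrite -mulr_sumr sqrtrM ?sqr_ge0// sqrtr_sqr ger0_norm ?modulus_ge0.
- move=> x y; rewrite -(@ler_pXn2r _ 2) ?nnegrE ?addr_ge0 ?euclidean_norm_ge0//.
  rewrite sqrrD !sqr_sqrtr//.
  apply: (@le_trans _ _ (\sum_i (modulus (x i 0) + modulus (y i 0)) ^+ 2)).
    apply: ler_sum => i _; rewrite mxE ler_pXn2r ?nnegrE ?addr_ge0 ?modulus_ge0//.
    exact: modulusD.
  under eq_bigr do rewrite sqrrD.
  rewrite !big_split /= lerD2r lerD2l -mulr2n lerMn2r /= -sqrtrM//.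
  apply: le_trans (ler_norm _) _; rewrite -sqrtr_sqr ler_wsqrtr//.
  exact: sum_CauchySchwarz.
Qed.

Lemma euclidean_norm0 : E 0 = 0.
Proof.
have [_ _ Z _] := euclidean_vector_norm.
by rewrite -(scale0r 0) Z modulus0 mul0r.
Qed.

Let mxsum (A : 'M[K]_d) : R := \sum_i \sum_j modulus (A i j).

Lemma spectral_has_sup (A : 'M[K]_d) :
  has_sup [set E (A *m x) | x in [set x | E x <= 1]].
Proof.
split; first by exists (E (A *m 0)); exists 0 => //=; rewrite euclidean_norm0.
exists (mxsum A) => _ [x /= x1 <-].
apply: le_trans (euclidean_le_sum _) _; apply: ler_sum => i _.
rewrite mxE; apply: le_trans (modulus_sum _ _) _; apply: ler_sum => j _.
rewrite modulusM ler_piMr ?modulus_ge0//.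
exact: le_trans (modulus_le_euclidean _ _) x1.
Qed.

Lemma spectral_norm_le_sum A : sp A <= mxsum A.
Proof.
apply: ge_sup; first by case: (spectral_has_sup A).
move=> _ [x /= x1 <-].
apply: le_trans (euclidean_le_sum _) _; apply: ler_sum => i _.
rewrite mxE; apply: le_trans (modulus_sum _ _) _; apply: ler_sum => j _.
rewrite modulusM ler_piMr ?modulus_ge0//.
exact: le_trans (modulus_le_euclidean _ _) x1.
Qed.

Lemma spectral_norm_ub A x : E x <= 1 -> E (A *m x) <= sp A.
Proof.
move=> x1; apply: ub_le_sup; first by case: (spectral_has_sup A).
by exists x.
Qed.

Lemma modulus_le_spectral A i j : modulus (A i j) <= sp A.
Proof.
apply: le_trans (_ : E (A *m delta_mx j 0) <= _).
  by rewrite -colE -[A i j](_ : col j A i 0 = _) ?modulus_le_euclidean// mxE.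
apply: spectral_norm_ub; apply: le_trans (euclidean_le_sum _) _.
rewrite (bigD1 j)//= big1 ?addr0 => [|k kj]; rewrite mxE ?eqxx ?modulus1//.
by rewrite (negbTE kj) modulus0.
Qed.

Lemma spectral_norm_ge0 A : 0 <= sp A.
Proof.
apply: le_trans (spectral_norm_ub A (x := 0) _).
  exact: euclidean_norm_ge0.
by rewrite euclidean_norm0.
Qed.

Lemma spectral_norm0 : sp 0 = 0.
Proof.
apply/eqP; rewrite eq_le spectral_norm_ge0 andbT.
apply: le_trans (spectral_norm_le_sum _) _; rewrite /mxsum.
by under eq_bigr do (under eq_bigr do rewrite mxE modulus0); rewrite !big1_eq.
Qed.

Lemma spectral_normD A B : sp (A + B) <= sp A + sp B.
Proof.
have [_ _ _ D] := euclidean_vector_norm.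
apply: ge_sup; first by case: (spectral_has_sup (A + B)).
move=> _ [x /= x1 <-]; rewrite mulmxDl.
by apply: le_trans (D _ _) _; rewrite lerD// spectral_norm_ub.
Qed.

Lemma spectral_normN A : sp (- A) = sp A.
Proof.
have [_ _ Z _] := euclidean_vector_norm.
rewrite /spectral_norm /opnorm; congr sup; apply/seteqP; split => _ [x x1 <-];
  by exists x => //; rewrite mulNmx -scaleN1r Z modulusN modulus1 mul1r.
Qed.

Lemma spectral_distC A B : sp (A - B) = sp (B - A).
Proof. by rewrite -opprB spectral_normN. Qed.

Lemma compact_spectral_bounded (M : set 'M[K]_d) :
  compact M -> exists C, forall A, M A -> sp A <= C.
Proof.
move=> cM.
have cs : continuous (mxsum : 'M[K]_d -> R).
  apply: continuous_big => [|i _]; first exact: add_continuous.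
  apply: continuous_big => [|j _ A]; first exact: add_continuous.
  apply: (@continuous_comp _ _ _ (fun A : 'M[K]_d => A i j) modulus).
    exact: coord_continuous.
  exact: modulus_continuous.
have /compact_bounded[C [_ bC]] : compact (mxsum @` M).
  by apply: continuous_compact => //; exact: continuous_subspaceT.
exists (C + 1) => A MA; apply: le_trans (spectral_norm_le_sum _) _.
apply: le_trans (ler_norm _) _; apply: (bC (C + 1)); first by rewrite ltrDl.
by exists A.
Qed.

Lemma spectral_closure (N : set 'M[K]_d) A :
  (forall e, 0 < e -> exists2 B, N B & sp (A - B) < e) -> closure N A.
Proof.
move=> H U /nbhs_ballP[_ /gt0_of_real[e e0 <-] eU].
have [B NB AB] := H e e0; exists B; split => //; apply: eU.
split=> [|i j]; first by rewrite of_real_gt0.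
rewrite modulus_ball; apply: le_lt_trans AB.
by have := modulus_le_spectral (A - B) i j; rewrite !mxE.
Qed.

End EuclideanTheory.

Section HausdorffTheory.
Context {R : realType} {s : scalar_kind} {d : nat}.
Local Notation K := (scalar_field R s).
Local Notation sp := (@spectral_norm R s d).
Implicit Types (A B : 'M[K]_d) (M N P : hyperspace R s d).

Let dist_to A (N : set 'M[K]_d) : R := inf [set sp (A - B) | B in N].
Let excess (M N : set 'M[K]_d) : R := sup [set dist_to A N | A in M].

Let hausdorff_distE (M N : set 'M[K]_d) :
  hausdorff_dist M N = Num.max (excess M N) (excess N M).
Proof.
have dE : (fun B => inf [set sp (A - B) | A in M]) = dist_to^~ M.
  apply/funext => B; rewrite /dist_to.
  have -> // : (fun A => sp (A - B)) = (fun A => sp (B - A)).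
  by apply/funext => A; rewrite spectral_distC.
exact (congr1 (fun f : 'M[K]_d -> R =>
  Num.max (excess M N) (sup [set f B | B in N])) dE).
Qed.

Let dist_has_inf A N : has_inf [set sp (A - B) | B in N].
Proof.
split; last by exists 0 => _ [B _ <-]; exact: spectral_norm_ge0.
by have [B NB] := hyperspace_nonempty N; exists (sp (A - B)), B.
Qed.

Let dist_to_le A N B : hyperspace_set N B -> dist_to A N <= sp (A - B).
Proof.
by move=> NB; apply: ge_inf; [case: (dist_has_inf A N) | exists B].
Qed.

Let dist_to_ge0 A N : 0 <= dist_to A N.
Proof.
apply: lb_le_inf; first by case: (dist_has_inf A N).
by move=> _ [B _ <-]; exact: spectral_norm_ge0.
Qed.

Let dist_to_lt A N e : dist_to A N < e -> exists2 B, hyperspace_set N B & sp (A - B) < e.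
Proof.
rewrite -subr_gt0 => /inf_adherent/(_ (dist_has_inf A N))[_ [B NB <-]].
by rewrite [X in _ < X]subrKC => ?; exists B.
Qed.

Let excess_ub M N A : hyperspace_set M A -> dist_to A N <= excess M N.
Proof.
move=> MA; apply: ub_le_sup; last by exists A.
have [C bC] := compact_spectral_bounded (hyperspace_compact (h := M)).
have [B NB] := hyperspace_nonempty N.
exists (C + sp B) => _ [A' /bC A'C <-].
apply: le_trans (dist_to_le _ NB) _; apply: le_trans (spectral_normD _ _) _.
by rewrite spectral_normN lerD2r.
Qed.

Let excess_le M N e :
  (forall A, hyperspace_set M A -> exists2 B, hyperspace_set N B & sp (A - B) <= e) -> excess M N <= e.
Proof.
move=> H; apply: ge_sup.
  by have [A MA] := hyperspace_nonempty M; exists (dist_to A N), A.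
by move=> _ [A /H[B NB AB] <-]; exact: le_trans (dist_to_le _ NB) AB.
Qed.

Let excess_ge0 M N : 0 <= excess M N.
Proof.
have [A MA] := hyperspace_nonempty M.
exact: le_trans (dist_to_ge0 A N) (excess_ub _ MA).
Qed.

Let excess_triangle M N P : excess M P <= excess M N + excess N P.
Proof.
apply/ler_addgt0Pr => e e0; apply: excess_le => A MA.
have e20 : 0 < e / 2 by rewrite divr_gt0.
have /dist_to_lt[B NB AB] : dist_to A N < excess M N + e / 2.
  by apply: le_lt_trans (excess_ub _ MA) _; rewrite ltrDl.
have /dist_to_lt[C PC BC] : dist_to B P < excess N P + e / 2.
  by apply: le_lt_trans (excess_ub _ NB) _; rewrite ltrDl.
exists C => //; rewrite -(subrKA B) (le_trans (spectral_normD _ _))//.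
by rewrite (splitr e) addrACA lerD// ltW.
Qed.

Let excess_le0_sub M N : excess M N <= 0 -> M `<=` N.
Proof.
move=> MN0 A MA.
have /compact_closed : hausdorff_space 'M[K]_d by exact: norm_hausdorff.
move=> /(_ _ (hyperspace_compact (h := N))); apply.
apply: spectral_closure => e e0; apply: dist_to_lt.
by apply: le_lt_trans e0; exact: le_trans (excess_ub _ MA) MN0.
Qed.

Lemma hausdorff_distxx M : hausdorff_dist M M = 0.
Proof.
rewrite hausdorff_distE maxxx; apply/eqP; rewrite eq_le excess_ge0 andbT.
by apply: excess_le => A MA; exists A; rewrite // subrr spectral_norm0.
Qed.

Lemma hausdorff_dist_sym M N : hausdorff_dist M N = hausdorff_dist N M.
Proof. by rewrite !hausdorff_distE maxC. Qed.

Lemma hausdorff_dist_triangle N M P :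
  hausdorff_dist M P <= hausdorff_dist M N + hausdorff_dist N P.
Proof.
rewrite !hausdorff_distE ge_max; apply/andP; split.
  by rewrite (le_trans (excess_triangle M N P))// lerD// le_max lexx.
by rewrite (le_trans (excess_triangle P N M))// addrC lerD// le_max lexx orbT.
Qed.

Lemma hausdorff_dist_eq0 M N : hausdorff_dist M N = 0 -> M = N.
Proof.
move=> MN0; have : Num.max (excess M N) (excess N M) <= 0.
  by rewrite -hausdorff_distE MN0.
rewrite ge_max => /andP[/excess_le0_sub sMN /excess_le0_sub sNM].
have : hyperspace_set M = hyperspace_set N by apply/seteqP; split.
case: M N {MN0 sMN sNM} => [M M0 cM] [N N0 cN] /= MN.
by move: M0 cM; rewrite MN => M0 cM; congr Hyperspace; exact: Prop_irrelevance.
Qed.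

HB.instance Definition _ := gen_eqMixin (hyperspace R s d).
HB.instance Definition _ := gen_choiceMixin (hyperspace R s d).
HB.instance Definition _ := isMetric.Build R (hyperspace R s d)
  hausdorff_distxx hausdorff_dist_eq0 hausdorff_dist_sym hausdorff_dist_triangle.

Lemma hyperspace_mdistE M N : mdist M N = hausdorff_dist M N.
Proof. by []. Qed.

End HausdorffTheory.

(* Main.v *)
Require Import Defs.
From mathcomp Require Import all_boot all_order all_algebra.
From mathcomp Require Import all_classical all_reals all_analysis.
From mathcomp Require Import perm complex zify ring lra.

Set Implicit Arguments.
Unset Strict Implicit.
Unset Printing Implicit Defensive.

Import Order.TTheory GRing.Theory Num.Theory.
Import numFieldNormedType.Exports.

Local Open Scope classical_set_scope.
Local Open Scope ring_scope.

(** Let [r] and [r'] be the joint spectral radii of [M] and [M'], let [a_k] and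
    [a'_k] be the largest norms of their products of length [k], and let [dl]
    be the distance between [M] and [M'].  The joint spectral radius is bounded
    from below by quantities at one finite length through Bochi's inequality
    (lemma [bochi_jsr])
        [a'_(d k) <= c r'^k (a'_k)^(d - 1)],
    where [c] depends on the norm only.  Its two sides are controlled by
    comparing products over [M'] with nearby products over [M].  By hypothesis
    the products over [M] of length at most [n = d k] are bounded by
    [Theta n^(d - 1)] times the power of [r] of the same exponent, so that
    exchanging the factors one at a time changes a product of length [n] by at
    most [r^n / 2] once [Theta^2 n^(2 d - 1) dl] is small compared with [r]
    ([perturb_prods], [perturb_growth], [perturbation_small]).  Since
    [r^n <= a_n], Bochi's inequality then says
    [r^k <= C k^((d - 1)^2) r'^k].  For [k = m^2] the [k]-th root of the
    polynomial factor is [1 + O(1 / m)], hence [r' >= r (1 - c / m)]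
    ([root_estimate], [jsr_perturbation]).

    The constraint on [m] reads [m^(4 d - 2) dl <= const r].  For every [d >= 1]
    one has [4 d - 2 <= d^2 + d], so [m] of the order of
    [(r / dl)^(1 / (d^2 + d))] is admissible, and the loss [r / m] is
    [r^(1 - alpha) dl^alpha] with [alpha = 1 / (d^2 + d)].  This is uniform also
    for [r] tending to [0], because [r] is bounded on a compact family
    ([jsr_lower_hoelder]).  Exchanging [M] and [M'] gives Hoelder continuity.

    Bochi's inequality is proved as follows ([bochi_inequality]).  Suppose that
    the products of length [n] over [M] are [O(r^n)] and that [M] is bounded by
    [a].  The set [U] of the vectors [x] with [|S x| <= r^n] for all products
    [S] of all lengths [n] is mapped into itself by [r^-1 A] for [A] in [M].
    If [B] has columns in [U] and an almost maximal determinant, Cramer's rule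
    bounds the entries of [B^-1 A B] by [2 r] ([auerbach_basis]).  Gaussian
    elimination with complete pivoting writes [B = P D Q], where [D] is diagonal
    and [P], [Q] and their inverses are bounded in terms of [d]
    ([bounded_diagonal_factorization]).  In the basis given by [P], the
    [(i, j)] entry of [A] is thus [O(a)], and even [O(r)] when
    [|D_i| <= |D_j|].  A product of [d] such matrices is a sum over paths of [d]
    steps among [d] indices; [|D|] cannot decrease at every step of such a path,
    so each term contains a factor [O(r)] ([near_nilpotent_products_bound]). *)

(** * The modulus on the scalar field *)

Section Modulus.
Context {R : realType} {s : scalar_kind}.
Local Notation K := (scalar_field R s).

Lemma modulus_prod (I : Type) (r : seq I) (F : I -> K) :
  modulus (\prod_(i <- r) F i) = \prod_(i <- r) modulus (F i).
Proof.
by elim/big_ind2 : _ => [|a b c e <- <-|//]; rewrite ?modulus1 ?modulusM.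
Qed.

Lemma modulus_eq0 (x : K) : (modulus x == 0) = (x == 0).
Proof. by apply/eqP/eqP => [/modulus0_eq0|->]; rewrite ?modulus0. Qed.

Lemma modulus_gt0 (x : K) : (0 < modulus x) = (x != 0).
Proof. by rewrite lt_def modulus_ge0 andbT modulus_eq0. Qed.

Lemma modulusV (x : K) : modulus x^-1 = (modulus x)^-1.
Proof.
have [->|x0] := eqVneq x 0; first by rewrite invr0 modulus0 invr0.
apply: (mulfI (x := modulus x)); first by rewrite modulus_eq0.
by rewrite -modulusM !divff ?modulus1 ?modulus_eq0.
Qed.

Lemma modulus_sign n : modulus ((-1) ^+ n : K) = 1.
Proof.
elim: n => [|n IH]; first by rewrite expr0 modulus1.
by rewrite exprS modulusM IH modulusN modulus1 mulr1.
Qed.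

Lemma modulus_of_real (a : R) : modulus (of_real a : K) = `|a|.
Proof.
case: s => //=.
by rewrite expr0n /= addr0 sqrtr_sqr.
Qed.

End Modulus.

(** * The entrywise sum norm *)

Section SumNorm.
Context {R : realType} {s : scalar_kind}.
Local Notation K := (scalar_field R s).

(** This norm is submultiplicative on rectangular matrices too, so that products
    bring in no constants. *)
Definition sumnorm m n (A : 'M[K]_(m, n)) : R := \sum_i \sum_j modulus (A i j).

Lemma sumnorm_ge0 m n (A : 'M[K]_(m, n)) : 0 <= sumnorm A.
Proof. by do 2!apply: sumr_ge0 => ? _; exact: modulus_ge0. Qed.

Lemma sumnormD m n (A B : 'M[K]_(m, n)) : sumnorm (A + B) <= sumnorm A + sumnorm B.
Proof.
rewrite /sumnorm -big_split; apply: ler_sum => i _ /=.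
rewrite -big_split; apply: ler_sum => j _ /=.
by rewrite mxE modulusD.
Qed.

Lemma modulus_le_sumnorm m n (A : 'M[K]_(m, n)) i j : modulus (A i j) <= sumnorm A.
Proof.
rewrite /sumnorm (bigD1 i)//= (bigD1 j)//= -addrA lerDl addr_ge0//.
  by apply: sumr_ge0 => ? _; exact: modulus_ge0.
by do 2!apply: sumr_ge0 => ? _; exact: modulus_ge0.
Qed.

Lemma sumnorm_le m n (A : 'M[K]_(m, n)) e :
  (forall i j, modulus (A i j) <= e) -> sumnorm A <= (m * n)%:R * e.
Proof.
move=> Ae; apply: (le_trans (y := \sum_(i < m) \sum_(j < n) e)).
  by do 2!apply: ler_sum => ? _.
by rewrite !sumr_const !card_ord -mulrnA mulr_natl mulnC.
Qed.

Lemma sumnormM m n p (A : 'M[K]_(m, n)) (B : 'M[K]_(n, p)) :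
  sumnorm (A *m B) <= sumnorm A * sumnorm B.
Proof.
rewrite /sumnorm mulr_suml; apply: ler_sum => i _.
apply: (le_trans (y := \sum_(j < p) \sum_k modulus (A i k) * modulus (B k j))).
  apply: ler_sum => j _; rewrite mxE; apply: le_trans (modulus_sum _ _) _.
  by apply: ler_sum => k _; rewrite modulusM.
rewrite exchange_big mulr_suml; apply: ler_sum => k _ /=.
rewrite -mulr_sumr ler_wpM2l ?modulus_ge0//.
rewrite [leRHS](bigD1 k)//= lerDl.
by do 2!apply: sumr_ge0 => ? _; exact: modulus_ge0.
Qed.

Lemma sumnormM_le m n p (A : 'M[K]_(m, n)) (B : 'M[K]_(n, p)) a b :
  sumnorm A <= a -> sumnorm B <= b -> sumnorm (A *m B) <= a * b.
Proof.
move=> Aa Bb; apply: le_trans (sumnormM _ _) _.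
by apply: ler_pM => //; exact: sumnorm_ge0.
Qed.

Lemma sumnorm0 m n : sumnorm (0 : 'M[K]_(m, n)) = 0.
Proof.
by rewrite /sumnorm !big1// => i _; rewrite big1// => j _; rewrite mxE modulus0.
Qed.

Lemma sumnormZ m n x (A : 'M[K]_(m, n)) : sumnorm (x *: A) = modulus x * sumnorm A.
Proof.
rewrite /sumnorm mulr_sumr; apply: eq_bigr => i _.
by rewrite mulr_sumr; apply: eq_bigr => j _; rewrite mxE modulusM.
Qed.

Lemma sumnorm_le_const1 n (A : 'M[K]_n) :
  (forall i j, modulus (A i j) <= 1) -> sumnorm A <= (n * n)%:R.
Proof. by move=> /sumnorm_le; rewrite mulr1. Qed.

Lemma sumnorm1_le n : sumnorm (1%:M : 'M[K]_n) <= (n * n)%:R.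
Proof.
apply: sumnorm_le_const1 => i j; rewrite mxE.
by case: eqP; rewrite ?modulus1 ?modulus0.
Qed.

Lemma sumnorm_block_diag n (A : 'M[K]_n) :
  sumnorm (block_mx (1%:M : 'M[K]_1) 0 0 A) = 1 + sumnorm A.
Proof.
rewrite /sumnorm big_split_ord /= big_ord1 big_split_ord /= big_ord1.
rewrite block_mxEul mxE eqxx modulus1 big1 ?addr0; last first.
  by move=> j _; rewrite block_mxEur mxE modulus0.
congr (_ + _); apply: eq_bigr => i _; rewrite big_split_ord /= big_ord1.
rewrite block_mxEdl mxE modulus0 add0r.
by apply: eq_bigr => j _; rewrite block_mxEdr.
Qed.

End SumNorm.

(** * Complete pivoting *)

Section Pivoting.
Context {R : realType} {s : scalar_kind}.
Local Notation K := (scalar_field R s).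

Let lower n (v : 'cV[K]_n) : 'M[K]_(1 + n) := block_mx 1%:M 0 v 1%:M.
Let upper n (u : 'rV[K]_n) : 'M[K]_(1 + n) := block_mx 1%:M u 0 1%:M.

Let lowerV n (v : 'cV[K]_n) : lower v *m lower (- v) = 1%:M.
Proof.
rewrite /lower mulmx_block !mulmx1 !mul1mx !mul0mx !mulmx0 !addr0 add0r subrr.
by rewrite -scalar_mx_block.
Qed.

Let upperV n (u : 'rV[K]_n) : upper u *m upper (- u) = 1%:M.
Proof.
rewrite /upper mulmx_block !mulmx1 !mul1mx !mul0mx !mulmx0 !addr0 add0r addNr.
by rewrite -scalar_mx_block.
Qed.

Let LDU n (a : 'M[K]_1) (u u' : 'rV[K]_n) (v v' : 'cV[K]_n) T :
  a *m u' = u -> v' *m a = v ->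
  block_mx a u v T = lower v' *m block_mx a 0 0 (T - v' *m u) *m upper u'.
Proof.
move=> <- <-; rewrite !mulmx_block !mulmx1 !mul1mx !mul0mx !mulmx0 !addr0 !add0r.
by rewrite -mulmxA addrC subrK.
Qed.

Let le_lower n (v : 'cV[K]_n) : (forall i, modulus (v i 0) <= 1) ->
  sumnorm (lower v) <= (n.+1 * n.+1)%:R.
Proof.
move=> v1; apply: (@sumnorm_le_const1 _ _ (1 + n)) => i j.
case: (split_ordP i) => i' ->; case: (split_ordP j) => j' ->.
- by rewrite block_mxEul mxE; case: eqP; rewrite ?modulus1 ?modulus0.
- by rewrite block_mxEur mxE modulus0.
- by rewrite block_mxEdl ord1 v1.
- by rewrite block_mxEdr mxE; case: eqP; rewrite ?modulus1 ?modulus0.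
Qed.

Let le_upper n (u : 'rV[K]_n) : (forall i, modulus (u 0 i) <= 1) ->
  sumnorm (upper u) <= (n.+1 * n.+1)%:R.
Proof.
move=> u1; apply: (@sumnorm_le_const1 _ _ (1 + n)) => i j.
case: (split_ordP i) => i' ->; case: (split_ordP j) => j' ->.
- by rewrite block_mxEul mxE; case: eqP; rewrite ?modulus1 ?modulus0.
- by rewrite block_mxEur ord1 u1.
- by rewrite block_mxEdl mxE modulus0.
- by rewrite block_mxEdr mxE; case: eqP; rewrite ?modulus1 ?modulus0.
Qed.

Let le_tperm n (i j : 'I_n) : sumnorm (tperm_mx i j : 'M[K]_n) <= (n * n)%:R.
Proof.
apply: sumnorm_le_const1 => k l; rewrite /tperm_mx /perm_mx !mxE.
by case: eqP; rewrite ?modulus1 ?modulus0.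
Qed.

Let tpermV n (i j : 'I_n) : tperm_mx i j *m tperm_mx i j = 1%:M :> 'M[K]_n.
Proof. by rewrite -perm_mxM tperm2 perm_mx1. Qed.

(** Pivoting on an entry of largest modulus makes all the multipliers of the
    elimination at most 1 in modulus, so that the elementary factors and their
    inverses have entries bounded by 1. This replaces the singular value
    decomposition: only bounds in terms of the size are needed. *)
Lemma bounded_diagonal_factorization n :
  exists2 c : R, 0 <= c & forall S : 'M[K]_n,
    exists P P' (D : 'rV_n) Q Q', [/\ P *m P' = 1%:M, Q *m Q' = 1%:M,
      S = P *m diag_mx D *m Q,
      sumnorm P <= c /\ sumnorm P' <= c & sumnorm Q <= c /\ sumnorm Q' <= c].
Proof.
elim: n => [|n [c c0 IH]].
  exists 0 => // S; exists 1%:M, 1%:M, 0, 1%:M, 1%:M.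
  have z (A : 'M[K]_0) : sumnorm A <= 0 by rewrite /sumnorm big_ord0.
  by split; rewrite ?mulmx1 ?z // [LHS]flatmx0 [RHS]flatmx0.
set q : R := (n.+1 * n.+1)%:R.
exists (q * q * (1 + c)) => [|S]; first by rewrite !mulr_ge0// addr_ge0.
pose p : 'I_n.+1 * 'I_n.+1 :=
  [arg max_(p > (ord0, ord0)) modulus (S p.1 p.2)]%O.
have pP i j : modulus (S i j) <= modulus (S p.1 p.2).
  by rewrite /p; case: arg_maxP => //= x _ /(_ (i, j)); apply.
pose Pr : 'M[K]_(1 + n) := tperm_mx ord0 p.1.
pose Pc : 'M[K]_(1 + n) := tperm_mx ord0 p.2.
pose S1 : 'M[K]_(1 + n) := Pr *m S *m Pc.
have S1E i j : S1 i j = S (tperm ord0 p.1 i) (tperm ord0 p.2 j).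
  by rewrite /S1 /Pr /Pc -xcolE -xrowE !mxE.
have SE : S = Pr *m S1 *m Pc.
  by rewrite /S1 -[RHS]mulmxA -(mulmxA _ Pc Pc) tpermV mulmx1 mulmxA tpermV mul1mx.
clearbody S1.
pose a := S1 0 0; pose u := ursubmx S1; pose v := dlsubmx S1.
have aE : modulus a = modulus (S p.1 p.2) by rewrite /a S1E !tpermL.
(* The convention 0^-1 = 0 covers the case S = 0: all entries then vanish. *)
have le_a (x : K) : modulus x <= modulus a ->
    a * (a^-1 * x) = x /\ modulus (a^-1 * x) <= 1.
  have [->|a_neq0] := eqVneq a 0 => xa.
    have /modulus0_eq0-> : modulus x = 0.
      by apply/eqP; rewrite eq_le modulus_ge0 andbT -(@modulus0 R s).
    by rewrite invr0 !mulr0 modulus0.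
  rewrite mulVKr ?unitfE//; split => //.
  by rewrite modulusM modulusV mulrC ler_pdivrMr ?modulus_gt0// mul1r.
have ua i : modulus (u 0 i) <= modulus a by rewrite aE !mxE S1E.
have va i : modulus (v i 0) <= modulus a by rewrite aE !mxE S1E.
have aS : ulsubmx S1 = a%:M.
  apply/matrixP => i j; rewrite !ord1 !mxE eqxx mulr1n.
  by congr (S1 _ _); apply/val_inj.
have [P1 [P1' [D1 [Q1 [Q1' [P1K Q1K TE [P1c P1'c] [Q1c Q1'c]]]]]]] :=
  IH (drsubmx S1 - (a^-1 *: v) *m u).
have PrV : Pr *m Pr = 1%:M by exact: tpermV.
have PcV : Pc *m Pc = 1%:M by exact: tpermV.
pose d1 (A : 'M[K]_n) : 'M[K]_(1 + n) := block_mx 1%:M 0 0 A.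
have d1M (A B : 'M[K]_n) : d1 A *m d1 B = d1 (A *m B).
  by rewrite /d1 mulmx_block !mulmx1 !mul0mx !mulmx0 !addr0 !add0r.
have d1c (A : 'M[K]_n) : sumnorm A <= c -> sumnorm (d1 A) <= 1 + c.
  by move=> Ac; rewrite sumnorm_block_diag lerD2l.
have d11 : d1 1%:M = 1%:M by rewrite /d1 -scalar_mx_block.
pose L := lower (a^-1 *: v); pose L' := lower (- (a^-1 *: v)).
pose U := upper (a^-1 *: u); pose U' := upper (- (a^-1 *: u)).
have Lc : sumnorm L <= q.
  by apply: le_lower => i; rewrite mxE; case: (le_a _ (va i)).
have L'c : sumnorm L' <= q.
  by apply: le_lower => i; rewrite mxE modulusN mxE; case: (le_a _ (va i)).
have Uc : sumnorm U <= q.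
  by apply: le_upper => i; rewrite mxE; case: (le_a _ (ua i)).
have U'c : sumnorm U' <= q.
  by apply: le_upper => i; rewrite mxE modulusN mxE; case: (le_a _ (ua i)).
exists (Pr *m L *m d1 P1), (d1 P1' *m L' *m Pr), (row_mx a%:M D1),
  (d1 Q1 *m U *m Pc), (Pc *m U' *m d1 Q1').
split.
- rewrite !mulmxA -(mulmxA _ (d1 P1)) d1M P1K d11 mulmx1.
  by rewrite -!mulmxA (mulmxA L) lowerV mul1mx PrV.
- rewrite !mulmxA -(mulmxA _ Pc Pc) PcV mulmx1 -(mulmxA _ U U') upperV mulmx1.
  by rewrite d1M Q1K d11.
- rewrite [LHS]SE -!mulmxA; congr (Pr *m _); rewrite !mulmxA; congr (_ *m Pc).
  have -> : diag_mx (row_mx a%:M D1) = block_mx a%:M 0 0 (diag_mx D1) :> 'M[K]_(1 + n).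
    rewrite diag_mx_row; congr block_mx.
    by apply/matrixP => i j; rewrite !ord1 !mxE eqxx.
  rewrite -[LHS](submxK S1) aS.
  have au : a%:M *m (a^-1 *: u) = u.
    by apply/matrixP => i j; rewrite ord1 mul_scalar_mx mxE mxE; case: (le_a _ (ua j)).
  have av : (a^-1 *: v) *m a%:M = v.
    apply/matrixP => i j; rewrite ord1 mul_mx_scalar mxE mxE.
    by case: (le_a _ (va i)).
  have dE : block_mx a%:M 0 0 (drsubmx S1 - (a^-1 *: v) *m u) =
      d1 P1 *m block_mx a%:M 0 0 (diag_mx D1) *m d1 Q1.
    by rewrite !mulmx_block !mulmx1 !mul1mx !mul0mx !mulmx0 !addr0 !add0r TE mul0mx.
  by rewrite [LHS](LDU _ au av) dE !mulmxA.
- split; first by do !apply: sumnormM_le => //; [exact: le_tperm | exact: d1c].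
  rewrite [leRHS]mulrC mulrA.
  by do !apply: sumnormM_le => //; [exact: d1c | exact: le_tperm].
- split; last by do !apply: sumnormM_le => //; [exact: le_tperm | exact: d1c].
  rewrite [leRHS]mulrC mulrA.
  by do !apply: sumnormM_le => //; [exact: d1c | exact: le_tperm].
Qed.

End Pivoting.

(** * Products with factors in a set *)

Section Products.
Context {R : realType} {s : scalar_kind} {d : nat}.
Local Notation K := (scalar_field R s).
Implicit Types (M : set 'M[K]_d) (S T A : 'M[K]_d).

Lemma mxprods0 M S : mxprods M 0 S <-> S = 1%:M.
Proof.
split=> [[A _ <-]|->]; first by rewrite big_ord0.
by exists (fun=> 0); [case | rewrite big_ord0].
Qed.

Lemma mxprodsS M k S :
  mxprods M k.+1 S <-> exists A T, [/\ M A, mxprods M k T & S = A *m T].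
Proof.
split=> [[A MA <-]|[A [_ [MA [B MB <-]] ->]]].
  exists (A ord_max), (\big[mulmx/1%:M]_(j < k) A (widen_ord (leqnSn k) (rev_ord j))).
  split=> //.
    by exists (fun j => A (widen_ord (leqnSn k) j)).
  rewrite big_ord_recl; congr (A _ *m _); first by apply/val_inj; rewrite /= subn1.
  by apply: eq_bigr => j _; congr (A _); apply/val_inj; rewrite /= subSS.
exists (fun j => if unlift ord_max j is Some i then B i else A) => /=.
  by move=> j; case: unliftP.
rewrite big_ord_recl; congr (_ *m _).
  have -> : rev_ord (ord0 : 'I_k.+1) = ord_max by apply/val_inj; rewrite /= subn1.
  by rewrite unlift_none.
apply: eq_bigr => j _.
have -> : rev_ord (lift ord0 j) = lift ord_max (rev_ord j).
  by apply/val_inj; have := ltn_ord j; rewrite /= /bump; lia.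
by rewrite liftK.
Qed.

Lemma mxprodsD M m n S :
  mxprods M (m + n) S <->
    exists S1 S2, [/\ mxprods M m S1, mxprods M n S2 & S = S1 *m S2].
Proof.
elim: m S => [|m IH] S.
  split=> [MS|[_ [S2 [/mxprods0-> MS2 ->]]]]; last by rewrite mul1mx.
  by exists 1%:M, S; split=> //; [exact/mxprods0 | rewrite mul1mx].
rewrite addSn; split=> [/mxprodsS[A [T [MA /IH[S1 [S2 [MS1 MS2 ->]]] ->]]]|].
  exists (A *m S1), S2; split=> //; last by rewrite mulmxA.
  by apply/mxprodsS; exists A, S1.
move=> [_ [S2 [/mxprodsS[A [T [MA MT ->]]] MS2 ->]]].
apply/mxprodsS; exists A, (T *m S2); split=> //; last by rewrite mulmxA.
by apply/IH; exists T, S2.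
Qed.

Lemma mxprods1 M A : mxprods M 1 A <-> M A.
Proof.
split=> [/mxprodsS[B [T [MB /mxprods0-> ->]]]|MA]; first by rewrite mulmx1.
by apply/mxprodsS; exists A, 1%:M; split; [|exact/mxprods0|rewrite mulmx1].
Qed.

Lemma mxprods_mxprods M k n S : mxprods (mxprods M k) n S <-> mxprods M (n * k) S.
Proof.
elim: n S => [|n IH] S; first by rewrite mul0n; split=> /mxprods0 /mxprods0.
rewrite mulSn; split=> [/mxprodsS[A [T [MA /IH MT ->]]]|].
  by apply/mxprodsD; exists A, T.
move=> /mxprodsD[A [T [MA /IH MT ->]]].
by apply/mxprodsS; exists A, T.
Qed.

Lemma mxprods_nonempty M k : M !=set0 -> mxprods M k !=set0.
Proof. by move=> [A MA]; exists (\big[mulmx/1%:M]_(j < k) A), (fun=> A). Qed.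

End Products.

(** * Bases of almost maximal determinant *)

Section Auerbach.
Context {R : realType} {s : scalar_kind} {d : nat}.
Local Notation K := (scalar_field R s).

Lemma det_bound (S : 'M[K]_d) :
  (forall i j, modulus (S i j) <= 1) -> modulus (\det S) <= d`!%:R.
Proof.
move=> S1; apply: le_trans (modulus_sum _ _) _.
apply: (@le_trans _ _ (\sum_(p : {perm 'I_d}) 1)).
  apply: ler_sum => p _; rewrite modulusM modulus_sign mul1r modulus_prod.
  by apply: prodr_ile1 => i _; rewrite modulus_ge0 S1.
by rewrite sumr_const card_Sn.
Qed.

(** Cramer's rule: the coordinates of [x] in the basis of the columns of [S]
    are quotients of determinants. *)
Lemma adj_mul_col (S : 'M[K]_d) (x : 'cV[K]_d) i :
  (\adj S *m x) i 0 = \det (\matrix_(k, l) if l == i then x k 0 else S k l).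
Proof.
rewrite (expand_det_col _ i) mxE; apply: eq_bigr => k _.
rewrite mulrC !mxE eqxx; congr (_ * _).
rewrite /cofactor; congr (_ * \det _); apply/matrixP => a b.
by rewrite !mxE eq_sym (negbTE (neq_lift _ _)).
Qed.

(** An almost maximal determinant suffices in place of a maximal one, hence no
    compactness: the factor 2 is the ratio allowed between [\det S] and the
    supremum. The vectors [t *: delta_mx j 0] make that supremum positive. *)
Lemma auerbach_basis (U : set 'cV[K]_d) (t : K) :
  (forall x, U x -> sumnorm x <= 1) -> t != 0 ->
  (forall j, U (t *: delta_mx j 0)) ->
  exists S : 'M[K]_d, [/\ S \in unitmx, forall j, U (col j S) &
    forall x, U x -> forall i, modulus ((invmx S *m x) i 0) <= 2].
Proof.
move=> U1 t0 Ut.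
pose E := [set modulus (\det S) | S in [set S : 'M[K]_d | forall j, U (col j S)]].
have Et : E (modulus (\det (t%:M : 'M[K]_d))).
  exists t%:M => // j; suff -> : col j t%:M = t *: delta_mx j 0 :> 'cV[K]_d by [].
  by apply/matrixP => a b; rewrite !mxE ord1 eqxx andbT mulr_natr.
have supE : has_sup E.
  split; first by eexists; exact: Et.
  exists d`!%:R => _ [S US <-]; apply: det_bound => i j.
  apply: le_trans (U1 _ (US j)).
  by have := modulus_le_sumnorm (col j S) i 0; rewrite mxE.
have E0 : 0 < sup E.
  apply: lt_le_trans (ub_le_sup supE.2 Et).
  by rewrite det_scalar modulus_gt0 expf_neq0.
have [_ [S US <-]] := sup_adherent (divr_gt0 E0 (ltr0n R 2)) supE.
have -> : sup E - sup E / 2 = sup E / 2 by field.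
move=> ltS; have detS : \det S != 0.
  by rewrite -modulus_gt0 (lt_trans _ ltS)// divr_gt0.
have Su : S \in unitmx by rewrite unitmxE unitfE.
exists S; split=> // x Ux i.
rewrite /invmx Su -scalemxAl mxE adj_mul_col modulusM modulusV.
rewrite mulrC ler_pdivrMr ?modulus_gt0//.
apply: (@le_trans _ _ (sup E)); last by rewrite mulrC -ler_pdivrMr// ltW.
apply: ub_le_sup; first exact: supE.2.
eexists; last reflexivity; move=> j /=.
have [->|ji] := eqVneq j i.
  by rewrite (_ : col i _ = x)//; apply/matrixP => a b; rewrite !mxE eqxx ord1.
rewrite (_ : col j _ = col j S)//.
by apply/matrixP => a b; rewrite !mxE (negbTE ji).
Qed.

End Auerbach.

(** * Products of nearly strictly triangular matrices *)

Section Nilpotent.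
Context {R : realType} {s : scalar_kind} {d : nat}.
Local Notation K := (scalar_field R s).
(** The entries of the matrices in [M] are at most [e] except where the weight
    [lam] strictly decreases from the row index to the column index. *)
Variables (lam : 'I_d -> R) (M : set 'M[K]_d) (a e : R).

Let rank i := #|[pred j | lam j < lam i]|.

Let rank_lt i j : lam j < lam i -> (rank j < rank i)%N.
Proof.
move=> ji; apply: proper_card; apply/properP; split.
  by apply/fintype.subsetP => k; rewrite !inE => /lt_trans; apply.
by exists j; rewrite !inE ?ji// ltxx.
Qed.

Let rank_max i : (rank i < d)%N.
Proof.
rewrite -[X in (_ < X)%N](card_ord d); apply: proper_card.
by apply/properP; split; [exact/fintype.subsetP | exists i; rewrite !inE ?ltxx].
Qed.

(** [X] collects the paths along which the weight strictly decreases at each of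
    the [n] steps, hence the rank drops by at least [n]; every other path has a
    step whose entry is at most [e], and [Y] is expanded according to the
    leftmost such step. *)
Lemma near_nilpotent_products n S :
  (forall A, M A -> sumnorm A <= a) ->
  (forall A, M A -> forall i j, lam i <= lam j -> modulus (A i j) <= e) ->
  mxprods M n S -> exists X Y, [/\ S = X + Y,
    forall i j, (rank i < rank j + n)%N -> X i j = 0,
    sumnorm S <= (d * d)%:R * a ^+ n
    & sumnorm Y <= n%:R * ((d * d)%:R ^+ 2 * e * a ^+ n.-1)].
Proof.
move=> Ma Me; elim: n S => [|n IH] S.
  move=> /mxprods0->; exists 1%:M, 0.
  split; rewrite ?addr0 ?sumnorm0 ?mul0r ?mulr1 ?sumnorm1_le// => i j.
  by rewrite addn0 mxE; case: eqP => [->|//]; rewrite ltnn.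
move=> /mxprodsS[A [T [MA MT ->]]].
have [X [Y [TE X0 Ta Ye]]] := IH _ MT.
pose A0 : 'M[K]_d := \matrix_(i, j) if lam j < lam i then A i j else 0.
pose A1 : 'M[K]_d := \matrix_(i, j) if lam j < lam i then 0 else A i j.
have AE : A = A0 + A1.
  by apply/matrixP => i j; rewrite !mxE; case: ifP; rewrite ?addr0 ?add0r.
have a0 : 0 <= a by apply: le_trans (Ma _ MA); exact: sumnorm_ge0.
have A0a : sumnorm A0 <= a.
  apply: le_trans (Ma _ MA); do 2!apply: ler_sum => ? _.
  by rewrite mxE; case: ifP; rewrite ?modulus0 ?modulus_ge0.
have A1e : sumnorm A1 <= (d * d)%:R * e.
  apply: sumnorm_le => i j; rewrite mxE; case: ltP => [_|ij].
    by rewrite modulus0 (le_trans _ (Me _ MA i i (lexx _)))// modulus_ge0.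
  exact: Me.
exists (A0 *m X), (A0 *m Y + A1 *m T); split.
- by rewrite {1}AE mulmxDl {1}TE mulmxDr addrA.
- move=> i j ij; rewrite mxE big1// => k _; rewrite mxE.
  case: ifP => [/rank_lt ki|_]; last by rewrite mul0r.
  by rewrite X0 ?mulr0//; lia.
- by rewrite exprS mulrCA sumnormM_le// Ma.
- apply: le_trans (sumnormD _ _) _.
  apply: le_trans (lerD (sumnormM_le A0a Ye) (sumnormM_le A1e Ta)) _.
  rewrite le_eqVlt; apply/orP; left; apply/eqP => /=.
  case: n {IH MT X0 Ta Ye} => [|n] /=; first ring.
  by rewrite [a ^+ n.+1]exprS -[n.+2%:R]natr1; ring.
Qed.

(** Ranks lie below [d], so they cannot drop by [d]: the part [X] vanishes. *)
Lemma near_nilpotent_products_bound S :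
  (forall A, M A -> sumnorm A <= a) ->
  (forall A, M A -> forall i j, lam i <= lam j -> modulus (A i j) <= e) ->
  mxprods M d S -> sumnorm S <= d%:R * ((d * d)%:R ^+ 2 * e * a ^+ d.-1).
Proof.
move=> Ma Me /(near_nilpotent_products Ma Me)[X [Y [-> X0 _]]].
suff -> : X = 0 by rewrite add0r.
by apply/matrixP => i j; rewrite mxE X0//; have := rank_max i; lia.
Qed.

End Nilpotent.

(** * Bochi's inequality *)

Section Bochi.
Context {R : realType} {s : scalar_kind} {d : nat}.
Local Notation K := (scalar_field R s).

(** The constant does not depend on [C]: the growth hypothesis makes [U] contain
    a basis, but the coordinates relative to the columns of [B] are bounded by
    ratios of determinants, in which the size of these columns cancels. *)
Lemma bochi_inequality : exists2 c : R, 0 < c &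
  forall (M : set 'M[K]_d) (a r : R), 0 < r ->
    (forall A, M A -> sumnorm A <= a) ->
    (exists C, forall n S, mxprods M n S -> sumnorm S <= C * r ^+ n) ->
    forall S, mxprods M d S -> sumnorm S <= c * r * a ^+ d.-1.
Proof.
have [c c0 fact] := @bounded_diagonal_factorization R s d.
pose q : R := (d * d)%:R.
pose c1 : R := c * (d%:R * (q ^+ 2 * (c * (q * 2) * c) * (c * c) ^+ d.-1)) * c.
have c10 : 0 <= c1 by rewrite /c1 !(mulr_ge0, exprn_ge0)// mulr_ge0.
exists (c1 + 1) => [|M a r r0 Ma [C MC] S MS]; first by rewrite ltr_wpDl.
have a0 : M !=set0 -> 0 <= a.
  by move=> [A /Ma]; apply: le_trans; exact: sumnorm_ge0.
(* U is the unit ball of the norm sup |T x| / r ^ n over all products T of all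
   lengths n, for which the operator norm of each A in M is at most r. *)
pose U := [set x : 'cV[K]_d | forall n T, mxprods M n T -> sumnorm (T *m x) <= r ^+ n].
have U1 x : U x -> sumnorm x <= 1.
  by move=> /(_ 0 1%:M); rewrite mul1mx; apply; exact/mxprods0.
pose C1 := Num.max C 1.
have C10 : 0 < C1 by rewrite lt_max ltr01 orbT.
pose t : K := of_real C1^-1.
have t0 : t != 0 by rewrite -modulus_gt0 modulus_of_real normr_gt0 invr_eq0 gt_eqF.
have Ut j : U (t *: delta_mx j 0).
  move=> n T MT; rewrite -scalemxAr.
  rewrite -colE sumnormZ modulus_of_real ger0_norm ?invr_ge0 ?(ltW C10)//.
  rewrite ler_pdivrMl//.
  apply: (@le_trans _ _ (sumnorm T)); last first.
    apply: le_trans (MC _ _ MT) _; rewrite ler_wpM2r ?exprn_ge0 ?(ltW r0)//.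
    by rewrite /C1 le_max lexx.
  rewrite /sumnorm; apply: ler_sum => i _; rewrite big_ord1 mxE.
  by rewrite (bigD1 j)//= lerDl sumr_ge0// => k _; exact: modulus_ge0.
have [B [Bu BU Bcoord]] := auerbach_basis U1 t0 Ut.
have BA A i j : M A -> modulus ((invmx B *m A *m B) i j) <= 2 * r.
  move=> MA.
  have UA : U (of_real r^-1 *: (A *m col j B)).
    move=> n T MT; rewrite -scalemxAr mulmxA.
    rewrite sumnormZ modulus_of_real ger0_norm ?invr_ge0 ?(ltW r0)//.
    rewrite ler_pdivrMl// -exprS; apply: BU; rewrite -addn1.
    by apply/mxprodsD; exists T, A; split=> //; exact/mxprods1.
  have := Bcoord _ UA i; rewrite -scalemxAr mxE modulusM modulus_of_real.
  rewrite ger0_norm ?invr_ge0 ?(ltW r0)// ler_pdivrMl// [r * 2]mulrC.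
  congr (modulus _ <= _).
  by rewrite mulmxA [RHS]mxE mxE; apply: eq_bigr => k _; rewrite [col j B k 0]mxE.
have [P [P' [D [Q [Q' [PK QK BE [Pc P'c] [Qc Q'c]]]]]]] := fact B.
have PK' : P' *m P = 1%:M by exact: mulmx1C.
have D0 i : D 0 i != 0.
  have : \det B != 0 by rewrite -unitfE -unitmxE.
  rewrite BE !det_mulmx det_diag !mulf_eq0 !negb_or => /andP[/andP[_ + _]].
  by move=> /prodf_neq0/(_ i isT).
pose M' := [set P' *m A *m P | A in M].
pose a' := c * a * c; pose e := c * (q * (2 * r)) * c.
have M'a A' : M' A' -> sumnorm A' <= a'.
  by move=> [A MA <-]; do !apply: sumnormM_le => //; exact: Ma.
have M'e A' : M' A' -> forall i j, modulus (D 0 i) <= modulus (D 0 j) ->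
    modulus (A' i j) <= e.
  move=> [A MA <-] i j ij.
  pose X := Q *m (invmx B *m A *m B) *m Q'.
  have Xe : sumnorm X <= e.
    apply: sumnormM_le Q'c; apply: sumnormM_le Qc _.
    by apply: sumnorm_le => k l; exact: BA.
  have XE : P' *m A *m P *m diag_mx D = diag_mx D *m X.
    have DE : P' *m B *m Q' = diag_mx D.
      by rewrite BE !mulmxA PK' mul1mx -mulmxA QK mulmx1.
    have DQ : diag_mx D *m Q = P' *m B by rewrite BE !mulmxA PK' mul1mx.
    have PD : P *m diag_mx D = B *m Q' by rewrite BE -mulmxA QK mulmx1.
    rewrite /X mulmxA mulmxA DQ -mulmxA PD !mulmxA; congr (_ *m _ *m _).
    by rewrite -(mulmxA P') mulmxV// mulmx1.
  have /matrixP/(_ i j) := XE; rewrite mul_mx_diag mul_diag_mx !mxE.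
  move=> /(congr1 modulus); rewrite !modulusM => ijE.
  apply: le_trans (le_trans (modulus_le_sumnorm X i j) Xe).
  rewrite -(ler_pM2r (_ : 0 < modulus (D 0 j))) ?modulus_gt0// mxE ijE.
  by rewrite mulrC ler_wpM2l// modulus_ge0.
have conj n T : mxprods M n T -> mxprods M' n (P' *m T *m P).
  elim: n T => [|n IH] T; first by move=> /mxprods0->; apply/mxprods0; rewrite mulmx1.
  move=> /mxprodsS[A [T' [MA /IH MT' ->]]]; apply/mxprodsS.
  exists (P' *m A *m P), (P' *m T' *m P); split=> //; first by exists A.
  by rewrite !mulmxA -(mulmxA _ P) PK mulmx1.
have := near_nilpotent_products_bound M'a M'e (conj _ _ MS) => S'b.
have -> : S = P *m (P' *m S *m P) *m P'.
  by rewrite !mulmxA PK mul1mx -mulmxA PK mulmx1.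
apply: le_trans (sumnormM_le (sumnormM_le Pc S'b) P'c) _.
have -> : c * (d%:R * (q ^+ 2 * e * a' ^+ d.-1)) * c = c1 * r * a ^+ d.-1.
  by rewrite /c1 /a' /e !exprMn; ring.
rewrite ler_wpM2r//; last by rewrite ler_wpM2r ?lerDl// ltW.
have [d1|d1] := posnP d.-1; first by rewrite d1.
apply/exprn_ge0/a0; have d0 := leq_trans d1 (leq_pred d).
have Mn n T : mxprods M n T -> (0 < n)%N -> M !=set0.
  by case: n => // n /mxprodsS[A [_ [MA _ _]]] _; exists A.
exact: Mn MS d0.
Qed.

End Bochi.

(** * Submultiplicative sequences *)

Section Fekete.
Context {R : realType}.

Lemma powR_inv_expr (x : R) n : 0 <= x -> (0 < n)%N -> (x `^ n%:R^-1) ^+ n = x.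
Proof.
move=> x0 n0.
by rewrite -powR_mulrn ?powR_ge0// -powRrM mulVf ?pnatr_eq0 -?lt0n// powRr1.
Qed.

Lemma powR_inv_le (x y : R) n : 0 <= x -> 0 <= y -> (0 < n)%N ->
  (x `^ n%:R^-1 <= y) = (x <= y ^+ n).
Proof.
move=> x0 y0 n0.
by rewrite -{2}(powR_inv_expr x0 n0) ler_pXn2r// nnegrE powR_ge0.
Qed.

Variable a : nat -> R.
Hypotheses (a_ge0 : forall n, 0 <= a n) (aD : forall m n, a (m + n) <= a m * a n).

Let aX m q s : a (q * m + s) <= a m ^+ q * a s.
Proof.
elim: q => [|q IH]; first by rewrite mul0n add0n expr0 mul1r.
rewrite mulSn -addnA exprS -mulrA (le_trans (aD _ _))//.
by rewrite ler_wpM2l.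
Qed.

Let growth_of_power m x : (0 < m)%N -> 0 < x -> a m <= x ^+ m ->
  exists C, forall n, a n <= C * x ^+ n.
Proof.
move=> m0 x0 am; exists (\sum_(i < m) a i / x ^+ i) => n.
rewrite {1 2}(divn_eq n m).
have nm : (n %% m < m)%N by rewrite ltn_mod.
apply: le_trans (aX _ _ _) _; rewrite exprD mulrCA ler_pM ?exprn_ge0//.
  by rewrite mulnC exprM lerXn2r// ?nnegrE// exprn_ge0 ?ltW.
rewrite -ler_pdivrMr ?exprn_gt0//.
rewrite (bigD1 (Ordinal nm))//= lerDl sumr_ge0// => i _.
by rewrite divr_ge0// exprn_ge0// ltW.
Qed.

Let eventually_le x y C : 0 < x -> x < y -> (forall n, a n <= C * x ^+ n) ->
  \forall n \near \oo, a n <= y ^+ n.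
Proof.
move=> x0 xy aC; have y0 := lt_trans x0 xy.
have z1 : `|x / y| < 1 by rewrite ger0_norm ?divr_ge0 ?ltW// ltr_pdivrMr// mul1r.
have /cvgrPdist_lt/(_ _ ltr01) := cvg_geometric C z1.
apply: filterS => n /=; rewrite sub0r normrN /geometric /= => Cn.
apply: le_trans (aC n) _; have := ltW (le_lt_trans (ler_norm _) Cn).
by rewrite expr_div_n mulrA ler_pdivrMr ?exprn_gt0// mul1r.
Qed.

Let b n := a n `^ n%:R^-1.
Let E := [set b n | n in [set n | (0 < n)%N]].

Let E_inf : has_inf E.
Proof. by split; [exists (b 1), 1 | exists 0 => _ [n _ <-]; exact: powR_ge0]. Qed.

Let L_ge0 : 0 <= inf E.
Proof. by apply: lb_le_inf E_inf.1 _ => _ [n _ <-]; exact: powR_ge0. Qed.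

Let L_growth y : inf E < y -> exists2 x, inf E <= x < y &
  0 < x /\ exists C, forall n, a n <= C * x ^+ n.
Proof.
move=> Ly; pose x := (inf E + y) / 2.
have Lx : inf E < x by rewrite /x; lra.
exists x; first by rewrite /x; apply/andP; split; lra.
have x0 : 0 < x by exact: le_lt_trans Lx.
split=> //; have := Lx; rewrite -subr_gt0 => /inf_adherent/(_ E_inf)[_ [m m0 <-]].
rewrite subrKC => bm; apply: (@growth_of_power m) => //.
by rewrite -powR_inv_le//; exact: ltW.
Qed.

(** Fekete's lemma, in the form used below: the limit of the [n]-th roots is
    their infimum, so it bounds each root from below, and any larger number
    bounds the growth of the whole sequence up to a constant. *)
Lemma fekete : [/\ 0 <= limn b,
  forall n, (0 < n)%N -> limn b ^+ n <= a n &
  forall y, limn b < y -> exists C, forall n, a n <= C * y ^+ n].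
Proof.
have b_cvg : b n @[n --> \oo] --> inf E.
  apply/cvgrPdist_le => e e0.
  have [x /andP[_ xy] [x0 [C aC]]] : exists2 x, inf E <= x < inf E + e &
      0 < x /\ exists C, forall n, a n <= C * x ^+ n by apply: L_growth; rewrite ltrDl.
  have := eventually_le x0 xy aC.
  near_simpl; apply: filter_app; exists 1 => // n /= n0 an.
  have Lb : inf E <= b n by apply: ge_inf; [exact: E_inf.2 | exists n].
  rewrite distrC ger0_norm ?subr_ge0// lerBlDl powR_inv_le//.
  by rewrite addr_ge0// ltW.
have -> : limn b = inf E by apply: cvg_lim.
split=> // [n n0|y Ly].
  rewrite -[leRHS](powR_inv_expr (a_ge0 n) n0).
  rewrite lerXn2r ?nnegrE ?powR_ge0//.
  by apply: ge_inf; [exact: E_inf.2 | exists n].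
have [x /andP[_ xy] [x0 [C aC]]] := L_growth Ly.
exists `|C| => n; apply: le_trans (aC n) _.
have x0' := ltW x0; have xy' := ltW xy.
apply: (@le_trans _ _ (`|C| * x ^+ n)).
  by rewrite ler_wpM2r ?exprn_ge0// ler_norm.
by rewrite ler_wpM2l// lerXn2r ?nnegrE// (le_trans x0').
Qed.

End Fekete.

(** * Equivalence of vector norms *)

Section NormEquivalence.
Context {R : realType} {s : scalar_kind} {d : nat}.
Local Notation K := (scalar_field R s).

(** Real coordinates transport compactness from real row vectors, so that both
    scalar fields are treated at once. *)
Definition of_pair (a b : R) : K :=
  match s return scalar_field R s with
  | RealScalars => a
  | ComplexScalars => Complex a b
  end.

Lemma of_pairB a b a' b' : of_pair a b - of_pair a' b' = of_pair (a - a') (b - b').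
Proof. by rewrite /of_pair; case: s. Qed.

Lemma modulus_of_pair a b : modulus (of_pair a b) <= `|a| + `|b|.
Proof.
rewrite /of_pair; case: s => /=; first by rewrite lerDl.
rewrite -(@ler_pXn2r _ 2) ?nnegrE ?sqrtr_ge0 ?addr_ge0//.
rewrite sqr_sqrtr ?addr_ge0 ?sqr_ge0// sqrrD !real_normK ?num_real//.
by rewrite lerD2r lerDl mulrn_wge0// mulr_ge0.
Qed.

Lemma of_pair_surj (z : K) :
  exists a b, [/\ z = of_pair a b, `|a| <= modulus z & `|b| <= modulus z].
Proof.
rewrite /of_pair; case: s z => /= [z|[a b]].
  by exists z, 0; rewrite normr0.
by exists a, b; rewrite -!sqrtr_sqr !ler_wsqrtr ?lerDl ?lerDr ?sqr_ge0.
Qed.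

Definition of_coords (w : 'rV[R]_(d + d)) : 'cV[K]_d :=
  \col_i of_pair (w 0 (lshift d i)) (w 0 (rshift d i)).

Lemma of_coordsB w w' : of_coords w - of_coords w' = of_coords (w - w').
Proof. by apply/matrixP => i j; rewrite !mxE of_pairB. Qed.

Lemma coord_le_norm m (w : 'rV[R]_m) j : `|w 0 j| <= `|w|.
Proof.
rewrite [leRHS]/Num.norm /= mx_normrE; apply/bigmax_geP; right => /=.
by exists (0, j).
Qed.

Lemma sumnorm_of_coords w : sumnorm (of_coords w) <= d%:R * (`|w| + `|w|).
Proof.
rewrite -[X in X%:R]muln1; apply: sumnorm_le => i j; rewrite mxE.
by apply: le_trans (modulus_of_pair _ _) _; rewrite lerD// coord_le_norm.
Qed.

Variable N : 'cV[K]_d -> R.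
Hypothesis hN : vector_norm N.

Lemma vector_norm0 : N 0 = 0.
Proof. by case: hN => _ _ Z _; rewrite -(scale0r 0) Z modulus0 mul0r. Qed.

Lemma vector_normN x : N (- x) = N x.
Proof. by case: hN => _ _ Z _; rewrite -scaleN1r Z modulusN modulus1 mul1r. Qed.

Lemma vector_norm_sum I (r : seq I) (F : I -> 'cV[K]_d) :
  N (\sum_(i <- r) F i) <= \sum_(i <- r) N (F i).
Proof.
case: hN => _ _ _ D; elim/big_ind2 : _ => [|a b c e ab ce|//].
  by rewrite vector_norm0.
by rewrite (le_trans (D _ _))// lerD.
Qed.

Lemma vector_norm_ub : exists2 c, 0 < c & forall x, N x <= c * sumnorm x.
Proof.
case: hN => N0 _ Z _.
exists (1 + \sum_(i < d) N (delta_mx i 0)) => [|x].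
  by rewrite ltr_pwDl// sumr_ge0.
rewrite {1}[x]matrix_sum_delta; apply: le_trans (vector_norm_sum _ _) _.
rewrite /sumnorm mulr_sumr; apply: ler_sum => i _.
rewrite !big_ord1 Z mulrC ler_wpM2r ?modulus_ge0//.
rewrite (bigD1 i)//= addrCA lerDl addr_ge0// sumr_ge0// => *.
Qed.

Lemma vector_norm_coords_continuous : continuous (N \o of_coords).
Proof.
have [c c0 Nc] := vector_norm_ub; case: hN => N0 _ _ D w.
have lip w' : `|N (of_coords w) - N (of_coords w')| <=
    c * (d%:R * (`|w - w'| + `|w - w'|)).
  apply: (@le_trans _ _ (N (of_coords w - of_coords w'))).
    rewrite ler_norml lerNl opprB !lerBlDr.
    apply/andP; split; last by rewrite -{1}(subrK (of_coords w') (of_coords w)).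
    rewrite -[of_coords w - _]opprB vector_normN.
    by rewrite -{1}(subrK (of_coords w) (of_coords w')).
  rewrite of_coordsB; apply: le_trans (Nc _) _.
  by rewrite ler_wpM2l ?sumnorm_of_coords// ltW.
apply/(@cvgrPdist_lt R R 'rV[R]_(d + d) (nbhs w) (nbhs_filter w)
  (N \o of_coords) _) => e e0.
pose k := c * (d%:R * 2) + 1.
have k0 : 0 < k by rewrite ltr_wpDl// !mulr_ge0// ltW.
have ek : 0 < e / k by rewrite divr_gt0.
near=> w'.
have : `|w - w'| < e / k by near: w'; apply: cvgr_dist_lt.
rewrite ltr_pdivlMr// => ww'.
apply: le_lt_trans (lip w') _; apply: le_lt_trans ww'.
rewrite /k; have := normr_ge0 (w - w'); nra.
Unshelve. all: by end_near. Qed.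

End NormEquivalence.

Section NormLower.
Context {R : realType} {s : scalar_kind} {d : nat}.
Local Notation K := (scalar_field R s).

Lemma sumnorm_vector_norm : vector_norm (@sumnorm R s d 1).
Proof.
split=> [x|x x0|a x|x y].
- exact: sumnorm_ge0.
- apply/matrixP => i j; rewrite [RHS]mxE; apply: modulus0_eq0; apply/eqP.
  by rewrite eq_le modulus_ge0 andbT -x0 modulus_le_sumnorm.
- exact: sumnormZ.
- exact: sumnormD.
Qed.

(** A norm is positive on the sphere of the sum norm and attains its minimum
    there. The sphere is parametrized by a compact set of real coordinates: the
    bound on [w] keeps it compact although [of_coords] need not be injective. *)
Lemma vector_norm_lb (N : 'cV[K]_d -> R) : vector_norm N ->
  exists2 c, 0 < c & forall x, sumnorm x <= c * N x.
Proof.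
move=> hN; have [N0 N1 NZ ND] := hN.
pose F := [set w : 'rV[R]_(d + d) | `|w| <= 1] `&`
          [set w | sumnorm (of_coords w : 'cV[K]_d) = 1].
have FN (x : 'cV[K]_d) : sumnorm x = 1 -> exists2 w, F w & x = of_coords w.
  move=> x1.
  have p i : {ab : R * R | [/\ x i 0 = of_pair ab.1 ab.2,
      `|ab.1| <= modulus (x i 0) & `|ab.2| <= modulus (x i 0)]}.
    apply: cid; have [a [b [? ? ?]]] := of_pair_surj (x i 0).
    by exists (a, b).
  pose w : 'rV[R]_(d + d) := \row_k match fintype.split k with
    | inl i => (sval (p i)).1 | inr i => (sval (p i)).2 end.
  have xw : x = of_coords w.
    apply/matrixP => i j; rewrite ord1 !mxE.
    rewrite (unsplitK (inl i)) (unsplitK (inr i)).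
    by case: (svalP (p i)).
  exists w => //; split; last by move: x1; rewrite [in X in X -> _]xw.
  rewrite /= [leLHS]/Num.norm /= mx_normrE; apply/bigmax_leP; split=> // -[i j] _ /=.
  rewrite mxE; case: (fintype.split j) => k; case: (svalP (p k)) => _ ab1 ab2;
    by rewrite -x1 (le_trans _ (modulus_le_sumnorm x k 0)).
have cF : compact F.
  apply: bounded_closed_compact.
    by exists 1; split=> // y y1 w [/= w1 _]; rewrite (le_trans w1)// ltW.
  apply: closedI.
    apply: (@preimage_closed _ _ (fun w : 'rV[R]_(d+d) => `|w|) [set y | y <= 1]).
      by move=> w _; exact: norm_continuous.
    exact: closed_le.
  apply: (@preimage_closed _ _ (@sumnorm R s d 1 \o of_coords) [set 1]).
    by move=> w _; exact: (vector_norm_coords_continuous sumnorm_vector_norm).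
  exact: closed_eq.
(* The sphere is empty only in dimension 0. *)
have [F0|F0] := pselect (F !=set0); last first.
  exists 1 => // x; rewrite mul1r; apply: contrapT => /negP; rewrite -ltNge => Nx.
  have x0 : 0 < sumnorm x by exact: le_lt_trans Nx.
  have [|w Fw _] := FN (of_real (sumnorm x)^-1 *: x); last by apply: F0; exists w.
  by rewrite sumnormZ modulus_of_real ger0_norm ?invr_ge0 ?(ltW x0)// mulVf ?gt_eqF.
have [|w /set_mem[_ w1] wmin] := @compact_EVT_min _ R (N \o of_coords) F F0 cF.
  exact/continuous_subspaceT/vector_norm_coords_continuous.
have m0 : 0 < N (of_coords w).
  rewrite lt_def N0 andbT; apply/eqP => /N1 w0.
  by move: w1; rewrite /= w0 sumnorm0 => /esym/eqP; rewrite oner_eq0.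
exists (N (of_coords w))^-1 => [|x]; first by rewrite invr_gt0.
have [x0|x0] := eqVneq (sumnorm x) 0; first by rewrite x0 mulr_ge0// invr_ge0 ltW.
have {}x0 : 0 < sumnorm x by rewrite lt_def x0 sumnorm_ge0.
have [|w' Fw' xw'] := FN (of_real (sumnorm x)^-1 *: x).
  by rewrite sumnormZ modulus_of_real ger0_norm ?invr_ge0 ?(ltW x0)// mulVf ?gt_eqF.
have := wmin w' (mem_set Fw'); rewrite /= -xw' NZ modulus_of_real.
rewrite ger0_norm ?invr_ge0 ?(ltW x0)// ler_pdivlMl// => h.
by rewrite ler_pdivlMl// mulrC.
Qed.

End NormLower.

(** * Operator norms *)

Section OperatorNorm.
Context {R : realType} {s : scalar_kind} {d : nat}.
Local Notation K := (scalar_field R s).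
Variable N : 'cV[K]_d -> R.
Hypothesis hN : vector_norm N.
Implicit Types (A B : 'M[K]_d) (x : 'cV[K]_d).

Lemma opnorm_has_sup A : has_sup [set N (A *m x) | x in [set x | N x <= 1]].
Proof.
have [c c0 Nc] := vector_norm_ub hN; have [e e0 eN] := vector_norm_lb hN.
split; first by exists (N (A *m 0)), 0 => //=; rewrite vector_norm0.
exists (c * (sumnorm A * e)) => _ [x /= x1 <-].
apply: le_trans (Nc _) _; rewrite ler_wpM2l//; first exact: ltW.
apply: sumnormM_le => //; apply: le_trans (eN x) _.
by rewrite ler_piMr// ltW.
Qed.

Lemma opnorm_ge0 A : 0 <= opnorm N A.
Proof.
have [N0 _ _ _] := hN; apply: le_trans (N0 (A *m 0)) _.
apply: ub_le_sup; first exact: (opnorm_has_sup A).2.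
by exists 0 => //=; rewrite vector_norm0.
Qed.

Lemma opnorm_mul A x : N (A *m x) <= opnorm N A * N x.
Proof.
have [N0 N1 NZ _] := hN.
have [Nx|Nx] := eqVneq (N x) 0.
  by rewrite (N1 _ Nx) mulmx0 vector_norm0// mulr0.
have {}Nx : 0 < N x by rewrite lt_def Nx N0.
have Nx' := ltW Nx.
pose y := of_real (N x)^-1 *: x.
have Ny z : N (of_real (N x)^-1 *: z) = N z / N x.
  by rewrite NZ modulus_of_real ger0_norm ?invr_ge0// mulrC.
rewrite -ler_pdivrMr// -Ny scalemxAr.
apply: ub_le_sup; first exact: (opnorm_has_sup A).2.
by exists y => //=; rewrite Ny divff ?gt_eqF.
Qed.

Lemma opnorm_le A b : (forall x, N x <= 1 -> N (A *m x) <= b) -> opnorm N A <= b.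
Proof.
move=> Ab; apply: ge_sup; first exact: (opnorm_has_sup A).1.
by move=> _ [x /= x1 <-]; exact: Ab.
Qed.

Lemma opnormM A B : opnorm N (A *m B) <= opnorm N A * opnorm N B.
Proof.
apply: opnorm_le => x x1; rewrite -mulmxA (le_trans (opnorm_mul _ _))//.
rewrite ler_wpM2l ?opnorm_ge0// (le_trans (opnorm_mul _ _))//.
by rewrite ler_piMr// opnorm_ge0.
Qed.

Lemma opnormD A B : opnorm N (A + B) <= opnorm N A + opnorm N B.
Proof.
have [_ _ _ ND] := hN; apply: opnorm_le => x x1.
rewrite mulmxDl (le_trans (ND _ _))//.
by rewrite lerD// (le_trans (opnorm_mul _ _))// ler_piMr// opnorm_ge0.
Qed.

Lemma opnorm0 : opnorm N 0 = 0.
Proof.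
apply/eqP; rewrite eq_le opnorm_ge0 andbT.
by apply: opnorm_le => x _; rewrite mul0mx vector_norm0.
Qed.

Lemma opnorm1_le : opnorm N 1%:M <= 1.
Proof. by apply: opnorm_le => x; rewrite mul1mx. Qed.

Lemma opnorm_le_sumnorm : exists2 c, 0 < c & forall A, opnorm N A <= c * sumnorm A.
Proof.
have [c c0 Nc] := vector_norm_ub hN; have [e e0 eN] := vector_norm_lb hN.
exists (c * e) => [|A]; first exact: mulr_gt0.
apply: opnorm_le => x x1; apply: le_trans (Nc _) _.
rewrite -mulrA ler_wpM2l ?(ltW c0)// mulrC sumnormM_le//.
by apply: le_trans (eN x) _; rewrite ler_piMr// ltW.
Qed.

Lemma sumnorm_le_opnorm : exists2 c, 0 < c & forall A, sumnorm A <= c * opnorm N A.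
Proof.
have [e e0 eN] := vector_norm_lb hN; have [N0 _ _ _] := hN.
exists (1 + e * \sum_j N (delta_mx j 0)) => [|A].
  by rewrite ltr_pwDl// mulr_ge0 ?sumr_ge0// ltW.
apply: (@le_trans _ _ (e * (\sum_j N (delta_mx j 0)) * opnorm N A)); last first.
  by rewrite ler_wpM2r ?opnorm_ge0// lerDr.
rewrite /sumnorm exchange_big mulr_sumr mulr_suml; apply: ler_sum => j _ /=.
apply: le_trans (_ : sumnorm (col j A) <= _).
  by apply: ler_sum => i _; rewrite big_ord1 mxE.
apply: le_trans (eN _) _; rewrite -mulrA ler_wpM2l ?(ltW e0)//.
by rewrite colE mulrC opnorm_mul.
Qed.

End OperatorNorm.

(** * The joint spectral radius and the growth of products *)

Section JSR.
Context {R : realType} {s : scalar_kind} {d : nat}.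
Local Notation K := (scalar_field R s).
Variable N : 'cV[K]_d -> R.
Hypothesis hN : vector_norm N.
Variable M : set 'M[K]_d.
Hypothesis M_nonempty : M !=set0.
Hypothesis M_bounded : exists C, forall A, M A -> opnorm N A <= C.

Local Notation growth k := (sup [set opnorm N S | S in mxprods M k]).

Let growth_has_sup k : has_sup [set opnorm N S | S in mxprods M k].
Proof.
split.
  by have [S MS] := mxprods_nonempty k M_nonempty; exists (opnorm N S), S.
have [C MC] := M_bounded; exists (C ^+ k) => _ [S MS <-].
elim: k S MS => [|k IH] S; first by move=> /mxprods0->; exact: opnorm1_le.
move=> /mxprodsS[A [T [MA /IH MT ->]]]; rewrite exprS (le_trans (opnormM hN _ _))//.
by rewrite ler_pM ?opnorm_ge0// MC.
Qed.

Lemma le_growth k S : mxprods M k S -> opnorm N S <= growth k.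
Proof. by move=> MS; apply: ub_le_sup; [exact: (growth_has_sup k).2 | exists S]. Qed.

Lemma growth_le k b : (forall S, mxprods M k S -> opnorm N S <= b) -> growth k <= b.
Proof.
move=> Mb; apply: ge_sup; first exact: (growth_has_sup k).1.
by move=> _ [S MS <-]; exact: Mb.
Qed.

Lemma growth_gt k b : b < growth k -> exists2 S, mxprods M k S & b < opnorm N S.
Proof.
rewrite -subr_gt0 => /sup_adherent/(_ (growth_has_sup k))[_ [S MS <-]].
by rewrite subKr => bS; exists S.
Qed.

Lemma growth_ge0 k : 0 <= growth k.
Proof.
have [S MS] := mxprods_nonempty k M_nonempty.
by apply: le_trans (le_growth MS); exact: opnorm_ge0.
Qed.

Lemma growthD m n : growth (m + n) <= growth m * growth n.
Proof.
apply: growth_le => _ /mxprodsD[S [T [MS MT ->]]].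
by rewrite (le_trans (opnormM hN _ _))// ler_pM ?opnorm_ge0// le_growth.
Qed.

Lemma joint_spectral_radiusP : [/\ 0 <= joint_spectral_radius N M,
  forall n, (0 < n)%N -> joint_spectral_radius N M ^+ n <= growth n &
  forall y, joint_spectral_radius N M < y ->
    exists C, forall n S, mxprods M n S -> opnorm N S <= C * y ^+ n].
Proof.
have [J0 Jle Jlt] := fekete growth_ge0 growthD.
split=> // y /Jlt[C MC]; exists C => n S MS.
exact: le_trans (le_growth MS) (MC n).
Qed.

End JSR.

Section BochiGrowth.
Context {R : realType} {s : scalar_kind} {d : nat}.
Local Notation K := (scalar_field R s).
Variable N : 'cV[K]_d -> R.
Hypothesis hN : vector_norm N.

(** Bochi's inequality applied to the set of products of length [k], whose
    products of length [n] grow like [r ^+ (k * n)] for every [r] larger than the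
    joint spectral radius. *)
Lemma bochi_jsr : exists2 c, 0 < c & forall (M : set 'M[K]_d),
  M !=set0 -> (exists C, forall A, M A -> opnorm N A <= C) ->
  forall k a r, 0 <= a -> (forall S, mxprods M k S -> opnorm N S <= a) ->
  joint_spectral_radius N M < r ->
  forall S, mxprods M (d * k) S -> opnorm N S <= c * r ^+ k * a ^+ d.-1.
Proof.
have [c c0 bochi] := @bochi_inequality R s d.
have [e e0 eN] := opnorm_le_sumnorm hN; have [f f0 fN] := sumnorm_le_opnorm hN.
exists (e * c * f ^+ d.-1) => [|M M0 Mb k a r a0 Ma Mr S MS].
  by rewrite !mulr_gt0// exprn_gt0.
have [J0 _ /(_ r Mr)[C MC]] := joint_spectral_radiusP hN M0 Mb.
have r0 : 0 < r by exact: le_lt_trans Mr.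
apply: le_trans (eN _) _; rewrite -!mulrA ler_wpM2l ?(ltW e0)//.
have -> : c * (f ^+ d.-1 * (r ^+ k * a ^+ d.-1)) = c * r ^+ k * (f * a) ^+ d.-1.
  by rewrite exprMn; ring.
apply: (bochi (mxprods M k)); first exact: exprn_gt0.
- by move=> A MA; rewrite (le_trans (fN A))// ler_wpM2l ?(ltW f0)// Ma.
- exists (f * C) => n T /mxprods_mxprods/MC MT.
  rewrite (le_trans (fN T))// -mulrA ler_wpM2l ?(ltW f0)//.
  by rewrite -exprM mulnC.
- exact/mxprods_mxprods.
Qed.

End BochiGrowth.

(** * Perturbation of long products *)

Section Perturbation.
Context {R : realType} {s : scalar_kind} {d : nat}.
Local Notation K := (scalar_field R s).
Variable N : 'cV[K]_d -> R.
Hypothesis hN : vector_norm N.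
Local Notation nu := (opnorm N).

Lemma opnormN A : nu (- A) = nu A.
Proof.
by rewrite /opnorm; congr sup; apply/seteqP; split=> _ [x x1 <-]; exists x;
  rewrite // mulNmx (vector_normN hN).
Qed.

Variables (M M' : set 'M[K]_d) (H rho dl : R) (n : nat).
Hypotheses (H_ge0 : 0 <= H) (rho_ge0 : 0 <= rho) (dl_ge0 : 0 <= dl).
Hypothesis MH : forall j S, (j <= n)%N -> mxprods M j S -> nu S <= H * rho ^+ j.

(** The left factor [T], itself a product over [M], absorbs the factors of [S]
    in the induction on [k]: everything on the left of an exchanged factor is
    then a product over [M], to which the growth bound applies. *)
Let close k (S S' : 'M[K]_d) := forall m T, (m + k <= n)%N -> mxprods M m T ->
  nu (T *m (S' - S)) <= H * rho ^+ m * ((rho + H * dl) ^+ k - rho ^+ k).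

Let close_norm k S S' : (k <= n)%N -> mxprods M k S -> close k S S' ->
  nu S' <= H * (rho + H * dl) ^+ k.
Proof.
move=> kn MS /(_ 0 1%:M kn); rewrite mul1mx expr0 mulr1 => /(_ _)SS'.
rewrite -(subrK S S') (le_trans (opnormD hN _ _))//.
apply: le_trans (lerD (SS' _) (MH kn MS)) _; first exact/mxprods0.
by rewrite -mulrDr subrK.
Qed.

Let close0 : close 0 1%:M 1%:M.
Proof. by move=> m T _ _; rewrite subrr mulmx0 (opnorm0 hN) !expr0 subrr mulr0. Qed.

Let closeS k A A' S S' : (k < n)%N -> M A -> nu (A' - A) <= dl ->
  mxprods M k S -> close k S S' -> close k.+1 (A *m S) (A' *m S').
Proof.
move=> kn MA AA' MS SS' m T mkn MT.
have -> : T *m (A' *m S' - A *m S) = T *m (A' - A) *m S' + (T *m A) *m (S' - S).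
  by rewrite !(mulmxBr, mulmxBl) !mulmxA addrA subrK.
have MTA : mxprods M m.+1 (T *m A).
  by rewrite -addn1; apply/mxprodsD; exists T, A; split=> //; exact/mxprods1.
have mkn' : (m.+1 + k <= n)%N by lia.
have h1 := SS' _ _ mkn' MTA.
have h2 : nu (T *m (A' - A) *m S') <= H * rho ^+ m * dl * (H * (rho + H * dl) ^+ k).
  rewrite (le_trans (opnormM hN _ _))// ler_pM ?opnorm_ge0//.
    rewrite (le_trans (opnormM hN _ _))// ler_pM ?opnorm_ge0//.
    by apply: MH => //; lia.
  by apply: close_norm MS SS'; lia.
apply: le_trans (opnormD hN _ _) _; apply: le_trans (lerD h2 h1) _.
by rewrite le_eqVlt !exprS; apply/orP; left; apply/eqP; ring.
Qed.

(** The sum over all numbers of exchanged factors is a binomial expansion, which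
    is why [(rho + H * dl) ^+ k] appears. *)
Lemma perturb_prods k S : (forall A, M A -> exists2 A', M' A' & nu (A' - A) <= dl) ->
  (k <= n)%N -> mxprods M k S ->
  exists2 S', mxprods M' k S' & nu (S' - S) <= H * ((rho + H * dl) ^+ k - rho ^+ k).
Proof.
move=> MM' kn MS; suff [S' MS' SS'] : exists2 S', mxprods M' k S' & close k S S'.
  exists S' => //; have := SS' 0 1%:M kn; rewrite mul1mx expr0 mulr1; apply.
  exact/mxprods0.
elim: k S kn MS => [|k IH] S kn.
  by move=> /mxprods0->; exists 1%:M; [exact/mxprods0 | exact: close0].
move=> /mxprodsS[A [T [MA MT ->]]].
have [T' MT' TT'] := IH _ (ltnW kn) MT; have [A' MA' AA'] := MM' _ MA.
by exists (A' *m T'); [apply/mxprodsS; exists A', T' | exact: closeS].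
Qed.

Lemma perturb_growth k S' : (forall A', M' A' -> exists2 A, M A & nu (A' - A) <= dl) ->
  (k <= n)%N -> mxprods M' k S' -> nu S' <= H * (rho + H * dl) ^+ k.
Proof.
move=> M'M kn MS'; suff [S MS SS'] : exists2 S, mxprods M k S & close k S S'.
  exact: close_norm MS SS'.
elim: k S' kn MS' => [|k IH] S' kn.
  by move=> /mxprods0->; exists 1%:M; [exact/mxprods0 | exact: close0].
move=> /mxprodsS[A' [T' [MA' MT' ->]]].
have [T MT TT'] := IH _ (ltnW kn) MT'; have [A MA AA'] := M'M _ MA'.
by exists (A *m T); [apply/mxprodsS; exists A, T | exact: closeS].
Qed.

End Perturbation.

(** * Estimates for real numbers *)

Section RealEstimates.
Context {R : realType}.

Lemma expr1D_le (x : R) k : 0 <= x -> 2 * k%:R * x <= 1 ->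
  (1 + x) ^+ k <= 1 + 2 * k%:R * x.
Proof.
move=> x0; elim: k => [|k IH] kx; first by rewrite expr0 mulr0 mul0r addr0.
have kx' : 2 * k%:R * x <= 1.
  by apply: le_trans kx; rewrite ler_wpM2r// ler_wpM2l// ler_nat.
rewrite exprS; apply: le_trans (ler_wpM2l _ (IH kx')) _; first by rewrite addr_ge0.
rewrite -[k.+1%:R]natr1; move: (k%:R) kx' => z kx'.
have : 0 <= (1 - 2 * z * x) * x by rewrite mulr_ge0// subr_ge0.
rewrite -subr_ge0 => zx; rewrite -subr_ge0.
by apply: le_trans zx _; rewrite le_eqVlt; apply/orP; left; apply/eqP; ring.
Qed.

Lemma perturbation_small (H rho dl : R) n k : 1 <= H -> 0 < rho -> 0 <= dl ->
  4 * n%:R * H ^+ 2 * dl <= rho -> (k <= n)%N ->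
  H * ((rho + H * dl) ^+ k - rho ^+ k) <= rho ^+ k / 2.
Proof.
move=> H1 rho0 dl0 nH kn; have H0 : 0 < H by exact: lt_le_trans H1.
pose x := H * dl / rho.
have H0' := ltW H0; have rho0' := ltW rho0.
have x0 : 0 <= x by rewrite /x divr_ge0 ?mulr_ge0.
have -> : rho + H * dl = rho * (1 + x) by rewrite /x; field; rewrite gt_eqF.
have kx : 4 * k%:R * H * x <= 1.
  rewrite /x mulrA ler_pdivrMr// mul1r; apply: le_trans nH.
  have -> : 4 * k%:R * H * (H * dl) = k%:R * (4 * H ^+ 2 * dl) by ring.
  have -> : 4 * n%:R * H ^+ 2 * dl = n%:R * (4 * H ^+ 2 * dl) by ring.
  by rewrite ler_wpM2r ?ler_nat// !mulr_ge0// exprn_ge0.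
have kx' : 2 * k%:R * x <= 1.
  apply: le_trans kx; rewrite ler_wpM2r//.
  by have : 0 <= k%:R :> R by []; nra.
rewrite exprMn -{2}[rho ^+ k]mulr1 -mulrBr mulrCA ler_wpM2l ?exprn_ge0 ?(ltW rho0)//.
apply: (@le_trans _ _ (H * (2 * k%:R * x))).
  by rewrite ler_wpM2l ?(ltW H0)// lerBlDl expr1D_le.
move: kx; set y := _ * x; set z := H * _; have -> : y = 2 * z by rewrite /y /z; ring.
by move=> ?; lra.
Qed.

(** For [k = m ^ 2] the [k]-th root of [C * m ^+ p] is at most
    [expR ((ln C + p) / m)], using [m <= expR m]. *)
Lemma root_estimate (C rho r : R) m p : 1 <= C -> 0 < rho -> 0 < r -> (0 < m)%N ->
  rho ^+ (m ^ 2) <= C * m%:R ^+ p * r ^+ (m ^ 2) ->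
  rho * (1 - (ln C + p%:R) / m%:R) <= r.
Proof.
move=> C1 rho0 r0 m0 h; set c := ln C + _.
have m0' : 0 < m%:R :> R by rewrite ltr0n.
have C0 : 0 < C by exact: lt_le_trans C1.
apply: (@le_trans _ _ (rho * expR (- c / m%:R))).
  by rewrite ler_wpM2l ?(ltW rho0)// -mulNr expR_ge1Dx.
rewrite -(@ler_pXn2r _ (m ^ 2)) ?nnegrE ?mulr_ge0 ?expR_ge0
   ?(ltW rho0) ?(ltW r0)//; last first.
  by rewrite expn_gt0 m0.
have -> : (rho * expR (- c / m%:R)) ^+ (m ^ 2) = rho ^+ (m ^ 2) / expR (c * m%:R).
  rewrite exprMn -expRM_natl -expRN; congr (_ * expR _).
  by rewrite natrX; field; rewrite gt_eqF.
rewrite ler_pdivrMr ?expR_gt0// (le_trans h)// mulrC ler_wpM2l ?exprn_ge0 ?(ltW r0)//.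
rewrite /c mulrDl expRD ler_pM ?exprn_ge0 ?(ltW C0)//.
  rewrite -[leLHS](lnK (x := C)) ?posrE// ler_expR ler_peMr ?ln_ge0//.
  by rewrite ler1n.
rewrite expRM_natl lerXn2r ?nnegrE ?expR_ge0//.
by apply: le_trans (expR_ge1Dx _); rewrite lerDr.
Qed.

End RealEstimates.

(** * Choice of the length scale *)

Section Choice.
Context {R : realType}.

(** The witness is the integer part of [t `^ (- q^-1)]; rounding costs at most
    a factor 2 because that number is at least 1. *)
Lemma exists_scale (t : R) q : (0 < q)%N -> 0 < t <= 1 -> exists m,
  [/\ (0 < m)%N, m%:R ^+ q * t <= 1 & m%:R^-1 <= 2 * t `^ q%:R^-1].
Proof.
move=> q0 /andP[t0 t1]; set u := t `^ q%:R^-1.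
have u0 : 0 < u by rewrite powR_gt0.
have uq : u ^+ q = t by rewrite powR_inv_expr// ltW.
have u1 : u <= 1.
  by rewrite -(@ler_pXn2r _ q) ?nnegrE ?(ltW u0)// uq expr1n.
have u1' : 1 <= u^-1 by rewrite invf_ge1.
have m0 : (0 < Num.trunc u^-1)%N by rewrite truncn_gt0.
have /andP[mu um] := truncn_itv (le_trans ler01 u1').
exists (Num.trunc u^-1); split=> //.
  rewrite -uq -exprMn exprn_ile1// ?mulr_ge0// ?(ltW u0)//.
  by rewrite -ler_pdivlMr// div1r.
set m := Num.trunc _ in m0 mu um *.
have m0' : 0 < m%:R :> R by rewrite ltr0n.
rewrite invf_ple ?posrE ?mulr_gt0// invfM.
rewrite ler_pdivrMl// (le_trans (ltW um))// -natr1 mulr_natl mulr2n lerD2l.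
by rewrite ler1n.
Qed.

Lemma powR_rescale (x y a : R) : 0 < x -> 0 <= y ->
  x * (y / x) `^ a = x `^ (1 - a) * y `^ a.
Proof.
move=> x0 y0; have x0' := ltW x0.
rewrite -{1}[x](powRr1 x0') -{1}[1](subrK a) powRD; last by rewrite (gt_eqF x0) implybT.
by rewrite -mulrA -powRM ?divr_ge0// mulrCA divff ?gt_eqF// mulr1.
Qed.

(** With [t] the perturbation relative to [J], the scale [m] of order
    [t `^ (- q^-1)] makes the loss [J * c / m] of order [J * t `^ q^-1], which is
    [J `^ (1 - q^-1)] times a power of [D * dl]: only an upper bound on [J]
    enters, no lower one. *)
Lemma optimize_scale (J J' c D r dl : R) p q : (0 < q)%N -> (p <= q)%N ->
  0 < c -> 0 < D -> 0 < dl -> 0 < J -> J <= r -> 0 <= J' ->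
  (forall m, (0 < m)%N -> m%:R ^+ p * (D * dl) <= J -> J * (1 - c / m%:R) <= J') ->
  J - J' <= (1 + 2 * c) * (r `^ (1 - q%:R^-1) * D `^ q%:R^-1) * dl `^ q%:R^-1.
Proof.
move=> q0 pq c0 D0 dl0 J0 Jr J'0 step; set al := q%:R^-1.
have al0 : 0 <= al by rewrite invr_ge0.
have al1 : al <= 1 by rewrite invf_le1 ?ltr0n// ler1n.
have c1 : 1 <= 1 + 2 * c by rewrite lerDl mulr_ge0// ltW.
have y0 : 0 < D * dl by rewrite mulr_gt0.
pose t := D * dl / J; have t0 : 0 < t by rewrite divr_gt0.
suff main : J - J' <= (1 + 2 * c) * (J * t `^ al).
  apply: le_trans main _; rewrite -mulrA ler_wpM2l ?(le_trans ler01 c1)//.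
  rewrite powR_rescale ?(ltW y0)// -mulrA -powRM ?(ltW D0) ?(ltW dl0)//.
  rewrite ler_wpM2r ?powR_ge0// ge0_ler_powR ?subr_ge0 ?nnegrE ?(ltW J0)//.
  by rewrite (le_trans _ Jr)// ltW.
(* For t > 1 the distance is so large compared with J that J' >= 0 suffices. *)
have [t1|t1] := ltP 1 t.
  apply: (@le_trans _ _ J); first by rewrite gerBl.
  rewrite mulrCA ler_peMr ?(ltW J0)// mulr_ege1//.
  have <- : 1 `^ al = 1 :> R by rewrite powR1.
  by rewrite ge0_ler_powR ?nnegrE ?(ltW t0) ?(ltW t1).
have [m [m0 mt mal]] : exists m, [/\ (0 < m)%N, m%:R ^+ q * t <= 1 &
    m%:R^-1 <= 2 * t `^ al] by apply: exists_scale => //; rewrite t0.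
have low : J * (1 - c / m%:R) <= J'.
  apply: step => //; rewrite /t mulrA ler_pdivrMr// mul1r in mt.
  by apply: le_trans mt; rewrite ler_wpM2r ?(ltW y0)// ler_weXn2l ?ler1n.
have h : J * (c / m%:R) <= J * (c * (2 * t `^ al)).
  by rewrite ler_wpM2l ?(ltW J0)// ler_wpM2l ?(ltW c0).
have h2 : 0 <= J * t `^ al by rewrite mulr_ge0 ?powR_ge0 ?(ltW J0).
move: low h h2; rewrite !mulrDr mulr1; move: (t `^ al) (c / _) => u v; lra.
Qed.

End Choice.

(** * Lower bound for a nearby set *)

Section LowerBound.
Context {R : realType} {s : scalar_kind} {d : nat}.
Local Notation K := (scalar_field R s).
Variable N : 'cV[K]_d -> R.
Hypotheses (d_gt0 : (0 < d)%N) (hN : vector_norm N).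
Local Notation nu := (opnorm N).
Local Notation jsr := (joint_spectral_radius N).

(** Bochi's inequality for [M'] at length [d * k] with [k = m ^ 2]; the
    condition on [m] is the smallness required by [perturbation_small] for
    [n = d * k] and [H = Th * n ^+ d.-1]. *)
Lemma jsr_perturbation (Th : R) : 1 <= Th -> exists2 c, 0 < c & exists2 C, 0 < C &
  forall (M M' : set 'M[K]_d) dl,
    M !=set0 -> M' !=set0 ->
    (exists b, forall A, M A -> nu A <= b) -> (exists b, forall A, M' A -> nu A <= b) ->
    0 < jsr M ->
    (forall k, (0 < k)%N -> sup [set nu S | S in mxprods M k]
       <= Th * k%:R ^+ d.-1 * jsr M ^+ k) ->
    0 <= dl ->
    (forall A, M A -> exists2 A', M' A' & nu (A' - A) <= dl) ->
    (forall A', M' A' -> exists2 A, M A & nu (A' - A) <= dl) ->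
    forall m, (0 < m)%N -> C * m%:R ^+ (4 * d - 2) * dl <= jsr M ->
    jsr M * (1 - c / m%:R) <= jsr M'.
Proof.
move=> Th1; have [c0 c00 bochi] := bochi_jsr hN.
have Th0 : 0 <= Th by exact: le_trans Th1.
pose C2 := 1 + 4 * c0 * (2 * Th * d%:R ^+ d.-1) ^+ d.-1.
have C21 : 1 <= C2.
  rewrite lerDl mulr_ge0 ?mulr_ge0 ?(ltW c00)// exprn_ge0// mulr_ge0 ?exprn_ge0//.
  exact: mulr_ge0.
pose p := (2 * (d.-1 * d.-1))%N.
exists (1 + (ln C2 + p%:R)); first by rewrite ltr_pwDl// addr_ge0// ln_ge0.
exists (4 * d%:R * Th ^+ 2 * (d%:R ^+ d.-1) ^+ 2).
  by rewrite !mulr_gt0 ?exprn_gt0 ?ltr0n//; exact: lt_le_trans Th1.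
move=> M M' dl M0 M'0 Mb M'b J0 MTh dl0 MM' M'M m m0 mdl.
have J0' := ltW J0.
pose k := (m ^ 2)%N; pose n := (d * k)%N.
have k0 : (0 < k)%N by rewrite expn_gt0 m0.
have n0 : (0 < n)%N by rewrite muln_gt0 d_gt0.
pose H := Th * n%:R ^+ d.-1.
have H1 : 1 <= H.
  by rewrite -[1]mulr1 ler_pM// exprn_ege1// ler1n.
have H0 : 0 <= H by exact: le_trans H1.
have MH j S : (j <= n)%N -> mxprods M j S -> nu S <= H * jsr M ^+ j.
  move=> jn MS; have [j0|j0] := posnP j.
    move: MS; rewrite j0 expr0 mulr1 => /mxprods0->.
    exact: le_trans (opnorm1_le hN) H1.
  apply: le_trans (le_growth hN M0 Mb MS) _; apply: le_trans (MTh _ j0) _.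
  by rewrite ler_wpM2r ?exprn_ge0// ler_wpM2l// lerXn2r ?nnegrE ?ler_nat.
have small : 4 * n%:R * H ^+ 2 * dl <= jsr M.
  apply: le_trans mdl; rewrite le_eqVlt; apply/orP; left; apply/eqP.
  rewrite (_ : (4 * d - 2 = 2 + (d.-1 * 2 + d.-1 * 2))%N); last by lia.
  by rewrite /H /n /k natrM natrX !exprMn !exprD !exprM; ring.
have dle : (k <= n)%N by rewrite leq_pmull.
have [J1 J2 _] := joint_spectral_radiusP hN M0 Mb.
(* The supremum, which is at least jsr M ^+ n, is approached up to 3 / 4. *)
have [S MS Slarge] : exists2 S, mxprods M n S & 3 / 4 * jsr M ^+ n < nu S.
  apply: (growth_gt hN M0 Mb); apply: lt_le_trans (J2 _ n0).
  by rewrite gtr_pMl ?exprn_gt0//; lra.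
have [S' MS' SS'] := perturb_prods hN H0 J0' dl0 MH MM' (leqnn n) MS.
have S'large : jsr M ^+ n / 4 <= nu S'.
  have := perturbation_small H1 J0 dl0 small (leqnn n).
  have : nu S <= nu S' + nu (S' - S).
    by rewrite -(opnormN hN (S' - S)) opprB -{1}(subrKC S' S) opnormD.
  move: SS' Slarge; lra.
have M'k T : mxprods M' k T -> nu T <= 2 * H * jsr M ^+ k.
  move=> /(perturb_growth hN H0 J0' dl0 MH M'M dle) /le_trans; apply.
  have := perturbation_small H1 J0 dl0 small dle; rewrite mulrBr.
  have : jsr M ^+ k <= H * jsr M ^+ k by rewrite ler_peMl// exprn_ge0.
  have : 0 <= jsr M ^+ k by rewrite exprn_ge0.
  lra.
have a0 : 0 <= 2 * H * jsr M ^+ k by rewrite !mulr_ge0// exprn_ge0.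
have key r : jsr M' < r -> jsr M * (1 - (ln C2 + p%:R) / m%:R) <= r.
  move=> Mr; have [J'0 _ _] := joint_spectral_radiusP hN M'0 M'b.
  have r0 : 0 < r by exact: le_lt_trans Mr.
  apply: root_estimate => //; rewrite -/k.
  have nE : jsr M ^+ n = jsr M ^+ k * (jsr M ^+ k) ^+ d.-1.
    by rewrite -exprS prednK// -exprM mulnC.
  have h := le_trans S'large (bochi _ M'0 M'b _ _ _ a0 M'k Mr _ MS').
  rewrite nE [in leRHS]exprMn mulrA -mulrA in h.
  have q0 : 0 < (jsr M ^+ k) ^+ d.-1 by exact: exprn_gt0 _ (exprn_gt0 _ J0).
  have cancel (x q y : R) : 0 < q -> x * (q / 4) <= y * q -> x <= 4 * y.
    by move=> q1; rewrite mulrA ler_pdivrMr// mulrAC ler_pM2r// mulrC.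
  have := cancel _ _ _ q0 h.
  move=> /le_trans; apply.
  have -> : (2 * H) ^+ d.-1 = (2 * Th * d%:R ^+ d.-1) ^+ d.-1 * m%:R ^+ p.
    rewrite /H /n /k /p natrM natrX [(d%:R * _) ^+ _]exprMn !mulrA.
    by rewrite [LHS]exprMn -!exprM.
  have mr0 : 0 <= m%:R ^+ p * r ^+ k by rewrite mulr_ge0 ?exprn_ge0// ltW.
  rewrite /C2 -subr_ge0; apply: le_trans mr0 _.
  by rewrite le_eqVlt; apply/orP; left; apply/eqP; ring.
have {}key : jsr M * (1 - (ln C2 + p%:R) / m%:R) <= jsr M'.
  rewrite leNgt; apply/negP => lt.
  by have := key _ (midf_lt lt).1; rewrite leNgt (midf_lt lt).2.
apply: le_trans key; rewrite ler_wpM2l// lerD2l lerN2 ler_wpM2r ?invr_ge0//.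
by rewrite lerDr.
Qed.

End LowerBound.

(** * Compact families of compact sets *)

Section Hyperspace.
Context {R : realType} {s : scalar_kind} {d : nat}.
Local Notation K := (scalar_field R s).
Local Notation sp := (@spectral_norm R s d).
Implicit Types M : hyperspace R s d.

Lemma hausdorff_dist_lt M (M' : hyperspace R s d) e A : hausdorff_dist M M' < e ->
  hyperspace_set M A -> exists2 B, hyperspace_set M' B & sp (A - B) < e.
Proof.
move=> Me MA; pose E := [set sp (A - B) | B in hyperspace_set M'].
have [B0 MB0] := hyperspace_nonempty M'.
have lb0 A' : lbound [set sp (A' - B) | B in hyperspace_set M'] 0.
  by move=> _ [B _ <-]; exact: spectral_norm_ge0.
have Einf : has_inf E by split; [exists (sp (A - B0)), B0 | exists 0; exact: lb0].
have Ee : inf E < e.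
  apply: le_lt_trans Me; rewrite le_max; apply/orP; left.
  apply: ub_le_sup; last by exists A.
  have [C bC] := compact_spectral_bounded (hyperspace_compact (h := M)).
  exists (C + sp B0) => _ [A' /bC A'C <-].
  apply: (@le_trans _ _ (sp (A' - B0))).
    by apply: ge_inf; [exists 0; exact: lb0 | exists B0].
  by apply: le_trans (spectral_normD _ _) _; rewrite spectral_normN lerD2r.
have := Ee; rewrite -subr_gt0 => /inf_adherent/(_ Einf)[_ [B MB <-]].
by rewrite subrKC => ?; exists B.
Qed.

Lemma hausdorff_dist_ge0 M (M' : hyperspace R s d) : 0 <= hausdorff_dist M M'.
Proof. by rewrite -hyperspace_mdistE; exact: mdist_ge0. Qed.

Lemma compact_hyperspaces_bounded (KK : set (hyperspace R s d)) : compact KK ->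
  exists C, forall M, KK M -> forall A, hyperspace_set M A -> sp A <= C.
Proof.
have [[M0 KM0]|K0] := pselect (KK !=set0); last first.
  by exists 0 => M KM; case: K0; exists M.
move=> /compact_near_coveringP/(_ nat \oo (fun n M => mdist M0 M < n%:R)) cK.
have [n _ /(_ n (leqnn n)) Kn] : \forall n \near \oo, KK `<=` (fun M => mdist M0 M < n%:R).
  apply: cK => M KM.
  exists (ball M 1, [set n | mdist M0 M + 1 < n%:R]).
    split; first exact: nbhsx_ballx.
    exact: nbhs_infty_gtr.
  move=> [M' n] [/=]; rewrite ballEmdist /= => MM' Mn.
  apply: le_lt_trans Mn; apply: le_trans (hausdorff_dist_triangle M _ _) _.
  by rewrite lerD2l ltW.
have [C bC] := compact_spectral_bounded (hyperspace_compact (h := M0)).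
exists (n%:R + C) => M KM A MA.
have := Kn M KM; rewrite /= hyperspace_mdistE hausdorff_dist_sym.
move=> /hausdorff_dist_lt/(_ MA)[B MB AB].
by rewrite -(subrK B A) (le_trans (spectral_normD _ _))// lerD ?bC// ltW.
Qed.

End Hyperspace.

(** * Uniform lower bound on a compact family *)

Section LowerHoelder.
Context {R : realType} {s : scalar_kind} {d : nat}.
Local Notation K := (scalar_field R s).
Variable N : 'cV[K]_d -> R.
Hypotheses (d_gt0 : (0 < d)%N) (hN : vector_norm N).
Local Notation jsr := (joint_spectral_radius N).

Lemma opnorm_le_spectral : exists2 e, 0 < e &
  forall A : 'M[K]_d, opnorm N A <= e * spectral_norm A.
Proof.
have [e e0 eN] := opnorm_le_sumnorm hN.
exists (e * (d * d)%:R) => [|A]; first by rewrite mulr_gt0// ltr0n muln_gt0 d_gt0.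
apply: le_trans (eN A) _; rewrite -mulrA ler_wpM2l ?(ltW e0)//.
by apply: sumnorm_le => i j; exact: modulus_le_spectral.
Qed.

(** Nearby factors are provided within twice the Hausdorff distance, because
    the infima in its definition are only approached; the case of distance zero
    is therefore separate. *)
Lemma jsr_lower_hoelder (KK : set (hyperspace R s d)) (Th : R) : compact KK ->
  (forall M : hyperspace R s d, KK M -> 0 < jsr M -> forall k, (0 < k)%N ->
     sup [set opnorm N S | S in mxprods M k] <= Th * k%:R ^+ d.-1 * jsr M ^+ k) ->
  exists2 Gamma : R, 0 < Gamma & forall M M' : hyperspace R s d, KK M -> KK M' ->
    jsr M - Gamma * hausdorff_dist M M' `^ (d ^ 2 + d)%N%:R^-1 <= jsr M'.
Proof.
move=> cK MTh; have [e e0 eN] := opnorm_le_spectral.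
have [B Bsp] := compact_hyperspaces_bounded cK.
pose Th1 := Num.max 1 Th.
have Th1_ge1 : 1 <= Th1 by rewrite le_max lexx.
have [c c0 [C C0 pert]] := jsr_perturbation d_gt0 hN Th1_ge1.
have bound (M : hyperspace R s d) : KK M ->
    exists b, forall A, hyperspace_set M A -> opnorm N A <= b.
  move=> KM; exists (e * B) => A MA; apply: le_trans (eN A) _.
  by rewrite ler_wpM2l ?(ltW e0)// (Bsp M).
have jsrP (M : hyperspace R s d) (KM : KK M) :=
  joint_spectral_radiusP hN (hyperspace_nonempty M) (bound M KM).
have [r r0 jsr_le] : exists2 r, 0 < r &
    forall M : hyperspace R s d, KK M -> jsr M <= r.
  exists (Num.max 1 (e * B)) => [|M KM]; first by rewrite lt_max ltr01.
  have [_ /(_ 1 isT) + _] := jsrP M KM; rewrite expr1 => /le_trans; apply.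
  rewrite le_max; apply/orP; right.
  apply: (growth_le hN (hyperspace_nonempty M) (bound M KM)) => A /mxprods1 MA.
  by apply: le_trans (eN A) _; rewrite ler_wpM2l ?(ltW e0)// (Bsp M).
pose D := C * (e * 2); have D0 : 0 < D by rewrite !mulr_gt0.
have pq : (4 * d - 2 <= d ^ 2 + d)%N.
  (* This amounts to (d - 1) (d - 2) >= 0. *)
  by case: (d) d_gt0 => [|[|n]] // _; rewrite expnS expn1; nia.
have q0 : (0 < d ^ 2 + d)%N by rewrite addn_gt0 d_gt0 orbT.
exists ((1 + 2 * c) * (r `^ (1 - (d ^ 2 + d)%N%:R^-1) * D `^ (d ^ 2 + d)%N%:R^-1)).
  by rewrite !mulr_gt0 ?powR_gt0// ltr_pwDl// mulr_ge0// ltW.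
move=> M M' KM KM'; have [J0 _ _] := jsrP M KM; have [J'0 _ _] := jsrP M' KM'.
have rhs0 : 0 <= (1 + 2 * c) *
    (r `^ (1 - (d ^ 2 + d)%N%:R^-1) * D `^ (d ^ 2 + d)%N%:R^-1) *
    hausdorff_dist M M' `^ (d ^ 2 + d)%N%:R^-1.
  by rewrite !mulr_ge0 ?powR_ge0// addr_ge0// mulr_ge0// ltW.
have [dl0|dl0] := eqVneq (hausdorff_dist M M') 0.
  by rewrite -(hausdorff_dist_eq0 dl0) in rhs0 *; rewrite lerBlDr lerDl.
have {}dl0 : 0 < hausdorff_dist M M' by rewrite lt_def dl0 hausdorff_dist_ge0.
have [M0|M0] := eqVneq (jsr M) 0.
  by rewrite M0 sub0r (le_trans _ J'0)// oppr_le0.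
have {M0}rho0 : 0 < jsr M by rewrite lt_def M0 J0.
rewrite lerBlDr -lerBlDl; set dl := hausdorff_dist M M' in dl0 rhs0 *.
apply: (optimize_scale q0 pq c0 D0 dl0 rho0 (jsr_le M KM) J'0) => m m0 mJ.
have near (P Q : hyperspace R s d) A : hausdorff_dist P Q = dl -> hyperspace_set P A ->
    exists2 B, hyperspace_set Q B & opnorm N (B - A) <= e * (2 * dl).
  move=> PQ PA; have PQ2 : hausdorff_dist P Q < 2 * dl by rewrite PQ ltr_pMl// ltr1n.
  have [A' QA' AA'] := hausdorff_dist_lt PQ2 PA; exists A' => //.
  by apply: le_trans (eN _) _; rewrite ler_wpM2l ?(ltW e0)// spectral_distC ltW.
apply: (pert M M' (e * (2 * dl))).
- exact: hyperspace_nonempty.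
- exact: hyperspace_nonempty.
- exact: bound.
- exact: bound.
- exact: rho0.
- move=> k k0; apply: le_trans (MTh M KM rho0 k k0) _.
  apply: (ler_wpM2r (exprn_ge0 k J0)).
  apply: (ler_wpM2r (exprn_ge0 d.-1 (ler0n R k))).
  by rewrite le_max lexx orbT.
- by apply: mulr_ge0; [exact: ltW | apply: mulr_ge0; [by [] | exact: ltW]].
- by move=> A; exact: near.
- move=> A' MA'.
  have [A MA AA'] := near M' M A' (hausdorff_dist_sym M' M) MA'.
  by exists A => //; rewrite -(opnormN hN) opprB.
- exact: m0.
- apply: le_trans mJ; rewrite le_eqVlt; apply/orP; left; apply/eqP.
  by rewrite /D; ring.
Qed.

End LowerHoelder.

(** * Hoelder continuity *)

Lemma mdist_regular (R : realType) (x y : R^o) : mdist x y = `|x - y|.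
Proof. by rewrite distrC. Qed.

Theorem theorem25 (R : realType) (s : scalar_kind) (d : nat) (hd : (1 <= d)%N)
    (N : 'cV[scalar_field R s]_d -> R) (hN : vector_norm N)
    (KK : set (hyperspace R s d)) (hKK : compact KK)
    (hbound : exists Theta : R, forall MM : hyperspace R s d,
       KK MM -> 0 < joint_spectral_radius N MM ->
       forall k : nat, (1 <= k)%N ->
         sup [set opnorm N S | S in mxprods MM k]
           <= Theta * k%:R ^+ (d - 1) * joint_spectral_radius N MM ^+ k) :
  (exists2 Gamma : R, 0 < Gamma &
     forall MM NN : hyperspace R s d, KK MM -> KK NN ->
       joint_spectral_radius N MM
         - Gamma * hausdorff_dist MM NN `^ (1 / (d ^ 2 + d)%N%:R)
         <= joint_spectral_radius N NN) /\
  hoelder_on KK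
    (fun MM : hyperspace R s d => joint_spectral_radius N MM : R^o)
    (1 / (d ^ 2 + d)%N%:R).
Proof.
have [Th MTh] := hbound; rewrite subn1 in MTh.
have [G G0 lower] := jsr_lower_hoelder hd hN hKK MTh.
rewrite div1r; split; first by exists G.
apply: (@le_lt_trans _ _ G%:E); last exact: ltry.
apply: ge_ereal_sup => _ [[M M'] [/= KM KM' MM'] <-].
have dM : 0 < mdist M M' by rewrite mdist_gt0; exact/eqP.
rewrite lee_fin ler_pdivrMr ?powR_gt0//.
rewrite [leLHS]mdist_regular.
rewrite ler_norml hyperspace_mdistE; apply/andP; split.
  by rewrite lerNl opprB lerBlDl -lerBlDr hausdorff_dist_sym lower.
by rewrite lerBlDl -lerBlDr lower.
Qed.
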